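(* Let $x\in\mathbb{R}$ be the multiplier to the forfeited stake upon declining a double, and $y\in\mathbb{R}^+$ the multiplier to the stake upon accepting a double, in the two-player game with an $(x,y)$-cube described in the context. The following doubling strategies are optimal, where $p$ denotes the evaluation of the player proposing the double: 1. If $x\ge y\ge 0$ and $y>1$, one should double at evaluation $p=1$. 2. If $x\ge 0$ and $y\le 1$, one should double at evaluation $p=0$. 3. If $x<0$, and $-x>1$ or $y>1$, then one should never double. 4. If $-1\le x\le 0$ and $y\le -x$, one should double at evaluation $p=0$.
   Context: The game. Two players A and B play for a stake, initially $1$. The game state is a driftless Brownian motion $p=p(t)$ in $[0,1]$ started at $1/2$; $p$ reaching $1$ means victory for Player A and $p$ reaching $0$ means victory for Player B. Player A's (subjective) game state is $p$ and Player B's is $1-p$; a player's game state equals the probability that the player would win if there were no doubling, called the player's evaluation. The $(x,y)$-cube. At any game state in the closed interval $[0,1]$ (including $0$ and $1$, with the final payoff made afterward) a player who has the right to do so may propose a double (play the cube). The first proposal may be made by either player; after a proposal the right to make the next one goes to the opponent, so proposals alternate. When a double is proposed, the opponent either folds, which ends the game with the opponent paying the proposer $x$ times the current stake (if $x<0$, the folding opponent thus receives $-x$ times the current stake), or accepts, in which case the stake is multiplied by $y$ and play continues. If the state reaches $0$ or $1$ and neither player would double, the game ends, the winner receives the current stake and the loser pays it. Both players play to maximize their expected payoff (and this is known to both); ''should'' refers to optimality with respect to this objective. *)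

(* Defs.v *)
From HB Require Import structures.
From mathcomp Require Import all_boot all_order all_algebra.
From mathcomp Require Import all_classical all_reals all_analysis.

Set Implicit Arguments.
Unset Strict Implicit.
Unset Printing Implicit Defensive.

Import Order.TTheory GRing.Theory Num.Theory.
Import numFieldNormedType.Exports.

Local Open Scope classical_set_scope.
Local Open Scope ring_scope.

Section BrownianMotion.
Context {d : measure_display} {Omega : measurableType d} {R : realType}.

(* Times are the nonnegative reals; values of [F] and of processes at negative
   times are never constrained or used. *)
Definition filtration (F : R -> set (set Omega)) : Prop :=
  [/\ forall t, 0 <= t -> sigma_algebra setT (F t),
      forall t, 0 <= t -> F t `<=` measurable
    & forall s t, 0 <= s -> s <= t -> F s `<=` F t].

Definition stopping_time (F : R -> set (set Omega)) (tau : Omega -> \bar R) :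
    Prop :=
  (forall w, (0 <= tau w)%E) /\
  (forall t, 0 <= t -> F t [set w | (tau w <= t%:E)%E]).

(* Driftless Brownian motion relative to the filtration [F], started at 0, with
   variance sigma^2 per unit of time: the increment over [s, t] is independent
   of [F s] and normal of standard deviation sigma * sqrt (t - s). *)
Definition brownian_motion (P : probability Omega R) (F : R -> set (set Omega))
    (sigma : R) (W : R -> Omega -> R) : Prop :=
  [/\ forall w, W 0 w = 0,
      forall w, {within `[0, +oo[, continuous (fun t => W t w)},
      forall t (B : set R), 0 <= t -> measurable B -> F t (W t @^-1` B)
    & forall s t (A : set Omega) (B : set R),
        0 <= s -> s < t -> F s A -> measurable B ->
        P (A `&` [set w | B (W t w - W s w)]) =
        (P A * normal_prob 0 (sigma * Num.sqrt (t - s)) B)%E].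

End BrownianMotion.

Inductive player := PlayerA | PlayerB.

Definition opponent (i : player) : player :=
  if i is PlayerA then PlayerB else PlayerA.

Definition player_eqb (i j : player) : bool :=
  match i, j with
  | PlayerA, PlayerA | PlayerB, PlayerB => true
  | _, _ => false
  end.

(* Who may make the next proposal: both players, or only one of them. *)
Inductive cube := Centered | OwnedBy of player.

Section Game.
Context {d : measure_display} {Omega : measurableType d} {R : realType}.

Definition sign_of (i : player) : R := if i is PlayerA then 1 else -1.

Definition evaluation (i : player) (p : R) : R :=
  if i is PlayerA then p else 1 - p.

Section State.
Variables (W : R -> Omega -> R) (p0 : R).

Definition exit_time (w : Omega) : \bar R :=
  ereal_inf [set t%:E | t in
    [set t : R | 0 <= t /\ (p0 + W t w <= 0 \/ 1 <= p0 + W t w)]].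

Definition game_state (t : R) (w : Omega) : R :=
  p0 + W (fine (Order.min t%:E (exit_time w))) w.

(* What Player A receives per unit of the final stake when the game is played
   out; 0 on the null event that the state never reaches 0 or 1. *)
Definition outcome (w : Omega) : R :=
  let q := game_state (fine (exit_time w)) w in
  if q == 1 then 1 else if q == 0 then -1 else 0.

End State.

(* Proposals made so far, the latest one first, each with its proposer and its
   time.  While a response is awaited the head is the pending proposal. *)
Definition history := seq (player * R).

Definition latest (h : history) : R := if h is (_, t) :: _ then t else 0.

(* [propose h w] is the time at which the player, if entitled to make the next
   proposal after the accepted proposals [h], makes it; a time beyond the end
   of the game, or +oo, stands for no proposal.  [accept h w] tells whether the
   player accepts the opponent's proposal at the head of [h]. *)
Record strategy := Strategy {
  propose : history -> Omega -> \bar R;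
  accept : history -> Omega -> bool
}.

Section Admissible.
Variable F : R -> set (set Omega).

Definition random_history := seq (player * (Omega -> \bar R)).

Definition realize (rh : random_history) (w : Omega) : history :=
  [seq (e.1, fine (e.2 w)) | e <- rh].

Definition rlatest (rh : random_history) (w : Omega) : \bar R :=
  if rh is (_, tau) :: _ then tau w else 0%E.

Fixpoint stopping_history (rh : random_history) : Prop :=
  if rh is (_, tau) :: rh' then
    [/\ stopping_time F tau, forall w, (rlatest rh' w <= tau w)%E
      & stopping_history rh']
  else True.

(* Decisions depend pointwise on the realized past proposals, and do not
   anticipate: whenever the past proposals occur at stopping times, so does the
   next one, and acceptance is decided on the information available at the time
   of the proposal.  As the times of a stopping history are ordered,
   [rlatest rh w < +oo] says that all its proposals are made. *)
Definition admissible (s : strategy) : Prop :=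
  [/\ forall h w, ((latest h)%:E <= propose s h w)%E,
      forall rh, stopping_history rh ->
        stopping_time F (fun w =>
          if (rlatest rh w < +oo)%E then propose s (realize rh w) w
          else +oo%E)
    & forall i tau rh, stopping_history ((i, tau) :: rh) ->
        stopping_time F (fun w =>
          if (tau w < +oo)%E && accept s (realize ((i, tau) :: rh) w) w
          then tau w else +oo%E)].

End Admissible.

Section Payoff.
Variables (W : R -> Omega -> R) (p0 x y : R) (tie : player)
  (s : player -> strategy).

(* If both players propose at the same moment while the cube is centered, the
   proposal of [tie] is the one that counts. *)
Definition next_proposal (c : cube) (h : history) (w : Omega) :
    player * \bar R :=
  match c with
  | OwnedBy i => (i, propose (s i) h w)
  | Centered =>
      let a := propose (s PlayerA) h w in
      let b := propose (s PlayerB) h w in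
      if (a < b)%E then (PlayerA, a)
      else if (b < a)%E then (PlayerB, b)
      else (tie, a)
  end.

(* What Player A receives, per unit of current stake, if the cube is withdrawn
   after [n] further accepted proposals. *)
Fixpoint gain_upto (n : nat) (c : cube) (h : history) (w : Omega) : R :=
  if n is m.+1 then
    let (i, t) := next_proposal c h w in
    if (t < +oo)%E && (t <= exit_time W p0 w)%E then
      let h' := (i, fine t) :: h in
      if accept (s (opponent i)) h' w
      then y * gain_upto m (OwnedBy (opponent i)) h' w
      else sign_of i * x
    else outcome W p0 w
  else outcome W p0 w.

(* The sequence is eventually constant if finitely many proposals are made.
   Otherwise it is y ^ n times the outcome for large n: endless doubling gives
   the winner the limiting stake, infinite if 1 < y. *)
Definition payoff (c : cube) (i : player) (w : Omega) : \bar R :=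
  ((sign_of i)%:E * limn (fun n => (gain_upto n c [::] w)%:E))%E.

End Payoff.

Definition deviate (s : player -> strategy) (i : player) (s' : strategy) :
    player -> strategy :=
  fun j => if player_eqb i j then s' else s j.

Definition expected_payoff (P : probability Omega R) (W : R -> Omega -> R)
    (p0 x y : R) (tie : player) (s : player -> strategy) (c : cube)
    (i : player) : \bar R :=
  (\int[P]_w payoff W p0 x y tie s c i w)%E.

(* No player can gain by a unilateral deviation, in the game with unit stake
   started at state [p0] with cube position [c].  The game being zero-sum, what
   player [i] obtains by deviating is written as minus what the opponent
   obtains: this is the same number when the expectation is defined, but when
   it is not the library's integral is -oo, so that the left-hand side below is
   +oo and the deviation is not counted as harmless. *)
Definition equilibrium (P : probability Omega R) (F : R -> set (set Omega))
    (W : R -> Omega -> R) (p0 x y : R) (tie : player) (c : cube)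
    (s : player -> strategy) : Prop :=
  [/\ forall i, admissible F (s i),
      forall i, P.-integrable setT (payoff W p0 x y tie s c i)
    & forall i s', admissible F s' ->
        (- expected_payoff P W p0 x y tie (deviate s i s') c (opponent i) <=
         expected_payoff P W p0 x y tie s c i)%E].

(* Proposal times as a function of the initial state and of the player. *)
Definition doubling_rule := R -> player -> history -> Omega -> \bar R.

(* Propose as soon as, and only when, one's own evaluation equals [a]. *)
Definition double_at (W : R -> Omega -> R) (a : R) : doubling_rule :=
  fun p0 i h w =>
    ereal_inf [set u%:E | u in
      [set u : R | latest h <= u /\ evaluation i (game_state W p0 u w) = a]].

Definition never_double : doubling_rule := fun _ _ _ _ => +oo%E.

(* The response to a double is decided by the responder's evaluation. *)
Definition strategy_of (W : R -> Omega -> R) (rule : doubling_rule)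
    (acc : R -> bool) (p0 : R) (i : player) : strategy :=
  Strategy (rule p0 i)
    (fun h w => acc (evaluation i (game_state W p0 (latest h) w))).

(* Both players doubling by [rule], with suitable responses to doubles, play
   optimally from every position.  The game itself starts from p0 = 1/2 with
   the cube centered; the other positions are those where play may have to be
   resumed, the stake being normalized to 1. *)
Definition optimal_doubling (P : probability Omega R)
    (F : R -> set (set Omega)) (W : R -> Omega -> R) (x y : R) (tie : player)
    (rule : doubling_rule) : Prop :=
  exists acc : R -> bool, forall (p0 : R) (c : cube), 0 <= p0 <= 1 ->
    equilibrium P F W p0 x y tie c (strategy_of W rule acc p0).

End Game.

(* Main.v *)
From HB Require Import structures.
Require Import Defs.
From mathcomp Require Import all_boot all_order all_algebra.
From mathcomp Require Import all_classical all_reals all_analysis measurable_realfun.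
From mathcomp Require Import ring lra.

Set Implicit Arguments.
Unset Strict Implicit.
Unset Printing Implicit Defensive.

Import Order.TTheory GRing.Theory Num.Theory.
Import numFieldNormedType.Exports.
Local Open Scope classical_set_scope.
Local Open Scope ring_scope.

(** Why the theorem is true.

    A response to doubles has to be chosen for each of the four cases, so that
    no unilateral deviation from the resulting profile pays.  A response that
    is never called upon when both players follow the rule need not be a best
    reply; it only has to make premature doubles unprofitable.  This leaves
    room for constant responses except in case 3: accept every double in cases
    1 and 2, fold to every double in case 4.

    Cases 1, 2 and 4 are decided path by path.  Doubling at evaluation 1 or 0
    means doubling when the game has just been won or lost; write o = 1 or
    o = -1 for the result at which the doubling takes place, and D for the
    factor by which it changes the payoff, namely y if the double is accepted
    and - x if it is folded to.  The player entitled to double receives D * o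
    instead of o when the result is o ([doubled_outcome]).  On every single
    path, a player who follows the rule and the constant response receives at
    least what results when both players do, whatever the opponent does instead
    ([gain_ge_doubled_outcome]).  The bounds for the two players are opposite
    to each other, so they determine the payoffs when both follow the rule, and
    integrating the bound of one player shows that the other cannot gain
    ([double_at_equilibrium]).

    In case 3 the opponent of a deviating player never doubles, so that the
    deviating player makes at most one proposal, at a stopping time tau.  Let m
    be the value at tau of the undoubled game for the proposer.  The opponent
    accepts when y * m <= x, which then costs no more than folding, and the
    proposer obtains min (x, y * m) in expectation.  This is at most m, under
    the hypotheses of case 3, so the proposal is not profitable.  The
    expectation of the outcome, given the information at tau, is indeed m:
    this is optional stopping for the Brownian motion up to the exit from the
    unit interval ([optional_stopping]), an interval which it leaves almost
    surely ([exit_never_null]).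

    Optional stopping at S is proved by sampling the path on a grid.  The sum
    of the increments over the grid cells that begin before S has mean zero,
    because an increment has mean zero on any event of its own past.  Without
    its last term, this sum is the value at the last grid point before S; it is
    bounded, since S does not exceed the exit time, and it converges to the
    state at S as the mesh shrinks ([cvg_grid_sum]).  The last term is small in
    mean: it is at most e plus the sum of all the fourth powers of the
    increments divided by e ^ 3, and a fourth power has a mean of the order of
    the square of the mesh ([integral_increment_pow4]).  The same sums show
    that the state at a stopping time tau is known at time tau
    ([stopped_value_filtration]), from which it follows that the strategies
    considered do not anticipate. *)

(** * The end of the game along a path *)

Section Signs.
Context {R : realType}.

Lemma sign_of_opponent (i : player) :
  sign_of (opponent i) = - sign_of i :> R.
Proof. by case: i; rewrite /= ?opprK. Qed.

Lemma sign_ofK (i : player) (a : R) : sign_of i * (sign_of i * a) = a.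
Proof. by case: i => /=; ring. Qed.

End Signs.

Section Paths.
Context {d : measure_display} {Omega : measurableType d} {R : realType}.
Variables (W : R -> Omega -> R) (p0 : R) (w : Omega).
Hypothesis W0 : W 0 w = 0.
Hypothesis Wc : {within `[0, +oo[, continuous (fun t => W t w)}.
Hypothesis p01 : 0 <= p0 <= 1.

Local Notation T := (exit_time W p0 w).
Local Notation gs := (fun t => game_state W p0 t w).
Local Notation O := (outcome W p0 w).

Lemma path_continuousP (r e : R) : 0 <= r -> 0 < e ->
  exists2 del, 0 < del &
    forall s, 0 <= s -> `|s - r| < del -> `|W s w - W r w| < e.
Proof.
move=> r0 e0.
have rI : [set` `[0, +oo[] r by rewrite /= in_itv/= r0.
have /subspace_continuousP/(_ r rI) := Wc.
move=> /cvgrPdist_lt /(_ e e0).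
rewrite near_withinE => /nbhs_ballP[del /= d0 Hd].
exists del => // s s0 sr; rewrite distrC.
by apply: Hd; rewrite /= ?in_itv/= ?s0// -ball_normE /= distrC.
Qed.

(** The infimum defining the exit time is attained, by continuity, and the
    state at that time is exactly 0 or 1. *)
Lemma exit_timeP :
  (exit_time W p0 w = +oo%E /\ forall t, 0 <= t -> 0 < p0 + W t w < 1) \/
  (exists r, [/\ 0 <= r, exit_time W p0 w = r%:E,
     p0 + W r w = 0 \/ p0 + W r w = 1
     & forall t, 0 <= t -> t < r -> 0 < p0 + W t w < 1]).
Proof.
set S := [set t : R | 0 <= t /\ (p0 + W t w <= 0 \/ 1 <= p0 + W t w)].
have notS t : 0 <= t -> ~ S t -> 0 < p0 + W t w < 1.
  move=> t0 St; apply/andP; split; rewrite ltNge; apply/negP => h; apply: St;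
    by split => //; by [left|right].
have [S0|/set0P Sn0] := eqVneq S set0.
  left; split; last by move=> t t0; apply: notS; rewrite // S0.
  by rewrite /exit_time -/S S0 image_set0 ereal_inf0.
right; pose r := inf S.
have lbS : has_inf S by split => //; exists 0 => t [].
have r0 : 0 <= r by apply: lb_le_inf => // t [].
have ltr_notS t : t < r -> ~ S t.
  move=> tr St; have : r <= t by apply: ge_inf => //; case: lbS.
  by rewrite leNgt tr.
exists r; split => //.
- by rewrite /exit_time -/S ereal_inf_EFin//; case: lbS.
- have Sr : p0 + W r w <= 0 \/ 1 <= p0 + W r w.
    apply: contrapT => nSr.
    have /andP[pr0 pr1] : 0 < p0 + W r w < 1.
      by apply: notS => // -[_ /nSr].
    have [del del0 Hdel] := @path_continuousP r
      (Num.min (p0 + W r w) (1 - (p0 + W r w))) r0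
      ltac:(by rewrite lt_min pr0 subr_gt0).
    have [s [s0 Ss] sr] := inf_adherent del0 lbS.
    have rs : r <= s by apply: ge_inf; [case: lbS|split].
    have := Hdel s s0.
    rewrite ger0_norm ?subr_ge0// ltrBlDl => /(_ sr).
    rewrite lt_min !ltr_norml => /andP[/andP[h1 h2] /andP[h3 h4]].
    by case: Ss => Ss; lra.
  (* The state cannot jump over 0 or 1: beyond it, an earlier time would do. *)
  have {Sr}[pr|pr] := Sr; [left|right]; apply/eqP; rewrite eq_le pr ?andbT/= leNgt;
      apply/negP => npr.
  + have r_gt0 : 0 < r.
      rewrite lt_neqAle r0 andbT; apply/eqP => r00.
      by move: npr p01; rewrite -r00 W0 addr0 => h1 /andP[h2 _]; lra.
    have [del del0 Hdel] := @path_continuousP r (- (p0 + W r w)) r0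
      ltac:(by rewrite oppr_gt0).
    pose s := Num.max 0 (r - del / 2).
    have s0 : 0 <= s by rewrite le_max lexx.
    have sr : s < r by rewrite gt_max r_gt0/=; lra.
    have : `|s - r| < del.
      by rewrite ler0_norm ?subr_le0 1?ltW// opprB ltrBlDl -ltrBlDr lt_max;
        apply/orP; right; lra.
    move=> /(Hdel s s0); rewrite ltr_norml => /andP[_ h].
    by apply: (ltr_notS s sr); split => //; left; lra.
  + have r_gt0 : 0 < r.
      rewrite lt_neqAle r0 andbT; apply/eqP => r00.
      by move: npr p01; rewrite -r00 W0 addr0 => h1 /andP[_ h2]; lra.
    have [del del0 Hdel] := @path_continuousP r (p0 + W r w - 1) r0
      ltac:(by rewrite subr_gt0).
    pose s := Num.max 0 (r - del / 2).
    have s0 : 0 <= s by rewrite le_max lexx.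
    have sr : s < r by rewrite gt_max r_gt0/=; lra.
    have : `|s - r| < del.
      by rewrite ler0_norm ?subr_le0 1?ltW// opprB ltrBlDl -ltrBlDr lt_max;
        apply/orP; right; lra.
    move=> /(Hdel s s0); rewrite ltr_norml => /andP[h _].
    by apply: (ltr_notS s sr); split => //; right; lra.
- by move=> t t0 tr; apply: notS => //; exact: ltr_notS.
Qed.

Lemma game_state_before t : (t%:E <= T)%E -> game_state W p0 t w = p0 + W t w.
Proof. by move=> tT; rewrite /game_state min_l. Qed.

Lemma game_state_after t : (T <= t%:E)%E ->
  game_state W p0 t w = p0 + W (fine T) w.
Proof. by move=> Tt; rewrite /game_state min_r. Qed.

(** Either the game never ends, or it ends at a time from which on the state
    remains equal to [(1 + O) / 2], that is, 1 or 0. *)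
Lemma game_endP :
  [/\ T = +oo%E, O = 0 & forall t, 0 <= t -> 0 < gs t < 1] \/
  (exists r, [/\ 0 <= r, T = r%:E, O = 1 \/ O = -1,
     forall t, r <= t -> gs t = (1 + O) / 2
     & forall t, 0 <= t -> t < r -> 0 < gs t < 1]).
Proof.
have [[T_oo in01]|[r [r0 Tr end01 in01]]] := exit_timeP.
  left; split => //.
    rewrite /outcome T_oo/= game_state_before ?T_oo ?leey//.
    have /andP[h1 h2] := in01 0 (lexx 0).
    by rewrite lt_eqF// gt_eqF.
  by move=> t t0; rewrite game_state_before ?T_oo ?leey//; exact: in01.
right; exists r; split => //.
- rewrite /outcome Tr/= game_state_before ?Tr//.
  by case: end01 => ->; rewrite ?eqxx; [right; rewrite lt_eqF|left].
- move=> t rt; rewrite /outcome !game_state_after ?Tr ?lee_fin//=.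
  case: end01 => ->; rewrite eqxx ?[0 == 1]lt_eqF//; lra.
- move=> t t0 tr; rewrite game_state_before ?Tr ?lee_fin 1?ltW//.
  exact: in01.
Qed.

Lemma game_state01 t : 0 <= t -> 0 <= game_state W p0 t w <= 1.
Proof.
move=> t0; have [[_ _ h]|[r [r0 Tr oO after before]]] := game_endP.
  by have /andP[/ltW-> /ltW->] := h t t0.
have [rt|tr] := leP r t; first by rewrite (after _ rt); case: oO => ->; lra.
by have /andP[/ltW-> /ltW->] := before t t0 tr.
Qed.

Lemma exit_time_ge0 : (0 <= T)%E.
Proof. by have [[-> _ _]|[r [r0 -> _ _ _]]] := game_endP. Qed.

Lemma outcome_norm_le1 : `|O| <= 1.
Proof.
have [[_ -> _]|[r [_ _ O1 _ _]]] := game_endP; first by rewrite normr0.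
by case: O1 => ->; rewrite ?normrN normr1.
Qed.

Lemma outcome_exit : (T < +oo)%E -> O = 2 * (p0 + W (fine T) w) - 1.
Proof.
have [[-> _ _]//|[r [r0 Tr _ after _]]] := game_endP.
have := after r (lexx r); rewrite game_state_after Tr ?lexx//= => -> _.
by field.
Qed.

(** Since the state reaches 0 or 1 only at the end of the game, doubling at
    evaluation 1 (o = 1) or 0 (o = -1) means doubling at the exit time, or at
    once when it is past, if one's result is o, and never otherwise. *)
Lemma double_atE (o : R) (i : player) (h : history) : o = 1 \/ o = -1 ->
  0 <= latest h ->
  double_at W ((1 + o) / 2) p0 i h w =
    if sign_of i * O == o then maxe (latest h)%:E T else +oo%E.
Proof.
move=> o1 l0; rewrite /double_at.
have evalE u : evaluation i (gs u) = (1 + sign_of i * (2 * gs u - 1)) / 2.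
  by case: i => /=; field.
set S := [set u : R | _].
have [[T_oo O0 in01]|[r [r0 Tr oO after before]]] := game_endP.
  have -> : S = set0.
    rewrite -subset0 => u [lu] /=; have := in01 u (le_trans l0 lu).
    by case: (i) o1 => /= -[->|->]; lra.
  rewrite image_set0 ereal_inf0 O0 mulr0 eq_sym.
  by case: o1 => ->; rewrite ?oppr_eq0 oner_eq0.
have [Oo|Oo] := eqVneq.
  have -> : S = [set u | Num.max (latest h) r <= u].
    apply/seteqP; split=> u /=; rewrite ge_max.
      move=> [lu]; rewrite evalE => gu; rewrite lu/= leNgt; apply/negP => ur.
      have := before u (le_trans l0 lu) ur.
      by move: o1 gu; case: (i) => /= -[->|->]; lra.
    move=> /andP[lu ru]; split => //; rewrite evalE (after _ ru) -Oo.
    by field.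
  apply/eqP; rewrite eq_le; apply/andP; split.
    apply: ereal_inf_lbound; exists (Num.max (latest h) r); rewrite /= ?lexx//.
    by rewrite Tr EFin_max.
  apply: le_ereal_inf_tmp => _ [u /= + <-].
  by rewrite Tr -EFin_max lee_fin.
have -> : S = set0; last by rewrite image_set0 ereal_inf0.
rewrite -subset0 => u [lu] /=; rewrite evalE.
have [ru|ur] := leP r u.
  rewrite (after _ ru) => h2; move/eqP: Oo; apply.
  by rewrite -[RHS](_ : 2 * ((1 + o) / 2) - 1 = o); [rewrite -h2; field|field].
have := before u (le_trans l0 lu) ur.
by move: o1; case: (i) => /= -[->|->]; lra.
Qed.

End Paths.

(** * Proposals and payoffs along a path *)

Section Proposals.
Context {d : measure_display} {Omega : measurableType d} {R : realType}.
Variables (W : R -> Omega -> R) (p0 x y : R) (tie : player).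
Variables (s : player -> @strategy d Omega R) (w : Omega).

Local Notation T := (exit_time W p0 w).
Local Notation O := (outcome W p0 w).
Local Notation gain := (fun n c h => gain_upto W p0 x y tie s n c h w).

Lemma next_proposalP (c : cube) (h : history) :
  exists2 k, next_proposal tie s c h w = (k, propose (s k) h w) &
    match c with
    | Centered => forall k', (propose (s k) h w <= propose (s k') h w)%E
    | OwnedBy i => k = i
    end.
Proof.
case: c => [|i]; last by exists i.
rewrite /next_proposal.
set a := propose _ h w; set b := propose _ h w.
case: ltgtP => ab; [exists PlayerA|exists PlayerB|exists tie] => //.
- by case => //; exact: ltW.
- by case => //; exact: ltW.
- by case: tie => //; rewrite -/a -/b ab.
- by case: tie; case => //; rewrite -/a -/b ab.
Qed.

(** No proposal counts exactly when no entitled player makes one in time;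
    which of two simultaneous proposals counts is left open, so that later
    arguments hold for either way of breaking ties. *)
Lemma gain_uptoSP (n : nat) (c : cube) (h : history) :
  gain n.+1 c h = O /\
    (forall k, match c with Centered => True | OwnedBy i => k = i end ->
      ~ ((propose (s k) h w < +oo)%E /\ (propose (s k) h w <= T)%E)) \/
  exists k, [/\ match c with Centered => True | OwnedBy i => k = i end,
    (propose (s k) h w < +oo)%E, (propose (s k) h w <= T)%E
    & let h' := (k, fine (propose (s k) h w)) :: h in
      gain n.+1 c h = if accept (s (opponent k)) h' w
        then y * gain n (OwnedBy (opponent k)) h' else sign_of k * x].
Proof.
have [k E ck] := next_proposalP c h; rewrite /= E.
case: ifP => [/andP[koo kT]|/negP kn].
  by right; exists k; split => //; case: (c) ck.
left; split => // k' ck' [k'oo k'T]; apply: kn.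
case: (c) ck ck' => [le _|i -> <-]; last by rewrite k'oo.
by rewrite (le_lt_trans (le _) k'oo) (le_trans (le _) k'T).
Qed.

Hypothesis W0 : W 0 w = 0.
Hypothesis Wc : {within `[0, +oo[, continuous (fun t => W t w)}.
Hypothesis p01 : 0 <= p0 <= 1.
Hypothesis y0 : 0 < y.

Lemma gain_upto_cases c h :
  (forall n, gain n c h = y ^+ n * O) \/
  exists N v, forall n, (N <= n)%N -> gain n c h = v.
Proof.
(* A first disagreement with y ^ n times the outcome shows that the
   sequence of proposals stops. *)
suff H n : forall c h, gain n c h <> y ^+ n * O ->
    exists N v, forall n, (N <= n)%N -> gain n c h = v.
  have [?|/existsNP[n hn]] := pselect (forall n, gain n c h = y ^+ n * O).
    by left.
  by right; exact: H hn.
elim: n => [|n IH] {}c {}h; first by rewrite /= expr0 mul1r.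
rewrite /=; case E : (next_proposal tie s c h w) => [i t].
case: ifPn => [ht|ht _]; last first.
  by exists 1%N, O; case=> // m _ /=; rewrite E (negbTE ht).
case: ifPn => [ha|ha _]; last first.
  exists 1%N, (sign_of i * x); case=> // m _ /=.
  by rewrite E ht (negbTE ha).
rewrite exprS -mulrA => hn.
have /IH [N [v hv]] : gain n (OwnedBy (opponent i)) ((i, fine t) :: h) <> y ^+ n * O.
  by move=> h2; apply: hn; rewrite h2.
exists N.+1, (y * v); case=> // m /= Nm; rewrite E ht ha.
by congr (_ * _); exact: hv.
Qed.

Lemma is_cvg_gain_upto c : cvgn (fun n => (gain n c [::])%:E).
Proof.
have [h|[N [v h]]] := gain_upto_cases c [::]; last first.
  apply/cvg_ex; exists v%:E; apply: cvg_near_cst.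
  by exists N => // n /= Nn; rewrite h.
under eq_fun do rewrite h.
have [Oge|Olt] := leP 0 O; have [y1|y1] := leP y 1.
- apply: ereal_nonincreasing_is_cvgn; apply/nonincreasing_seqP => n.
  by rewrite lee_fin exprS ler_wpM2r// ler_piMl// exprn_ge0// ltW.
- apply: ereal_nondecreasing_is_cvgn; apply/nondecreasing_seqP => n.
  by rewrite lee_fin exprS ler_wpM2r// ler_peMl ?(ltW y1)// exprn_ge0// ltW.
- apply: ereal_nondecreasing_is_cvgn; apply/nondecreasing_seqP => n.
  by rewrite lee_fin exprS ler_wnM2r ?(ltW Olt)// ler_piMl// exprn_ge0// ltW.
- apply: ereal_nonincreasing_is_cvgn; apply/nonincreasing_seqP => n.
  rewrite lee_fin exprS ler_wnM2r ?(ltW Olt)// ler_peMl ?(ltW y1)//.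
  by rewrite exprn_ge0// ltW.
Qed.

(** The limit defining the payoff exists along every path, even if proposals go
    on forever; hence bounds on the truncated games pass to the payoff. *)
Lemma payoff_ge c i (v : R) :
  (forall n, v <= sign_of i * gain n.+2 c [::]) ->
  (v%:E <= payoff W p0 x y tie s c i w)%E.
Proof.
move=> hv; have cv := is_cvg_gain_upto (c := c).
have hv2 : \forall n \near \oo, v <= sign_of i * gain n c [::].
  by exists 2%N => // -[|[|n]] //= _; exact: hv.
rewrite /payoff; case: i hv hv2 => /= hv hv2.
  rewrite mul1e; apply: lime_ge => //.
  by apply: filterS hv2 => n; rewrite mul1r lee_fin.
rewrite EFinN mulN1e leeNr -EFinN; apply: lime_le => //.
by apply: filterS hv2 => n; rewrite mulN1r lee_fin lerNr.
Qed.

Lemma payoff_opponent c i :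
  payoff W p0 x y tie s c (opponent i) w =
  (- payoff W p0 x y tie s c i w)%E.
Proof. by rewrite /payoff sign_of_opponent EFinN mulNe. Qed.

Lemma payoff_eventually c i (v : R) :
  (forall n, gain n.+2 c [::] = v) ->
  payoff W p0 x y tie s c i w = (sign_of i * v)%:E.
Proof.
move=> hv; rewrite /payoff EFinM; congr (_ * _)%E.
apply/cvg_lim => //; apply: cvg_near_cst.
by exists 2%N => // -[|[|n]] // _; congr _%:E; exact: hv.
Qed.

End Proposals.

(** * A pathwise saddle point for doubling at the end of the game *)

Section SaddlePoint.
Context {d : measure_display} {Omega : measurableType d} {R : realType}.
Variables (W : R -> Omega -> R) (p0 x y : R) (tie : player) (w : Omega).
Hypothesis W0 : W 0 w = 0.
Hypothesis Wc : {within `[0, +oo[, continuous (fun t => W t w)}.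
Hypothesis p01 : 0 <= p0 <= 1.

Local Notation T := (exit_time W p0 w).
Local Notation O := (outcome W p0 w).

(** The payoff of Player A when the outcome is [q] and each player, if entitled
    to, doubles on obtaining the result [o], which multiplies the payoff by
    [D].  From the centered cube one of the two players always does. *)
Definition doubled_outcome (D o : R) (c : cube) (q : R) : R :=
  match c with
  | Centered => D * q
  | OwnedBy i => if sign_of i * q == o then D * q else q
  end.

Variables (D o : R) (b : bool).
Hypothesis y0 : 0 < y.
Hypothesis o1 : o = 1 \/ o = -1.
Hypothesis D0 : 0 <= D.
(* Doubling at o is worth it: D * o is no worse than o, and neither folding nor
   accepting leaves the proposer with less than D * o. *)
Hypothesis D_own : [/\ o <= D * o, D * o <= x & D * o <= y * o].
(* An early double of the opponent does no harm: what it leaves to the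
   responder, y times a later payoff or - x, is no less than what the rule
   gives. *)
Hypothesis D_acc : b -> o <= y * o /\ y * o <= D * o.
Hypothesis D_fold :
  ~~ b -> [/\ o <= - x, D * o <= - x, - (D * o) <= - x & 0 <= - x].

Variables (s : player -> @strategy d Omega R) (j : player).
Hypothesis sj :
  s j = strategy_of W (double_at W ((1 + o) / 2)) (fun=> b) p0 j.
Hypothesis sprop :
  forall h, ((latest h)%:E <= propose (s (opponent j)) h w)%E.

Local Notation gain := (fun n c h => gain_upto W p0 x y tie s n c h w).
Local Notation opp := (opponent j).

Let in_game (h : @history R) := 0 <= latest h /\ ((latest h)%:E <= T)%E.

Let opponentK : opponent opp = j. Proof. by case: j. Qed.

Let propose_j h : in_game h ->
  propose (s j) h w = if sign_of j * O == o then T else +oo%E.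
Proof.
move=> [h0 hT]; rewrite sj/= (double_atE W0 Wc p01)//.
by case: ifP => // _; rewrite max_r.
Qed.

Let in_game_opp h : in_game h -> (propose (s opp) h w < +oo)%E ->
  (propose (s opp) h w <= T)%E ->
  in_game ((opp, fine (propose (s opp) h w)) :: h).
Proof.
move=> [h0 hT]; have := sprop h.
case: (propose _ _ _) => //= t; rewrite lee_fin => ht _ tT.
by split => //; exact: le_trans ht.
Qed.

Let in_game_j h : in_game h -> (propose (s j) h w < +oo)%E ->
  in_game ((j, fine (propose (s j) h w)) :: h).
Proof.
move=> hg; rewrite (propose_j hg); case: ifP => // _.
have [[-> _ _]//|[r [r0 Tr _ _ _]]] := game_endP W0 Wc p01; rewrite Tr.
by move=> _; split => //; rewrite Tr.
Qed.

Let entitled (k : player) (c : cube) : Prop :=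
  match c with Centered => True | OwnedBy i => k = i end.

Let gain_step n c h : in_game h ->
  [\/ gain n.+1 c h = O /\ (entitled j c -> sign_of j * O <> o),
    [/\ entitled j c, sign_of j * O = o & exists2 h', in_game h' &
      gain n.+1 c h = y * gain n (OwnedBy opp) h' \/
      gain n.+1 c h = sign_of j * x]
  | entitled opp c /\ exists2 h', in_game h' & gain n.+1 c h =
      if b then y * gain n (OwnedBy j) h' else - (sign_of j * x)].
Proof.
move=> hg; have [[-> none]|[k [ck koo kT ->]]] :=
    gain_uptoSP W p0 x y tie s w n c h.
  constructor 1; split => // cj Oo; apply: (none j cj).
  rewrite (propose_j hg) Oo eqxx lexx; split => //.
  have [[_ O0 _]|[r [_ -> _ _ _]]] := game_endP W0 Wc p01; last exact: ltry.
  by move: o1; rewrite -Oo O0 mulr0 => -[|] /eqP;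
    rewrite eq_sym ?oppr_eq0 oner_eq0.
have [kj|kj] : k = j \/ k = opp by case: (k) (j) => -[]; [left|right|right|left].
  subst k; constructor 2.
  have Oo : sign_of j * O = o.
    by apply/eqP/negP => /negP Oo; move: koo; rewrite (propose_j hg) (negbTE Oo).
  split => //; exists ((j, fine (propose (s j) h w)) :: h); first exact: in_game_j.
  by case: ifP; [left|right].
subst k; constructor 3; split => //.
exists ((opp, fine (propose (s opp) h w)) :: h); first exact: in_game_opp.
by rewrite opponentK sj sign_of_opponent mulNr.
Qed.

Let entitled_oppF : ~ entitled j (OwnedBy opp).
Proof. by rewrite /=; case: j. Qed.

Let entitled_jF : ~ entitled opp (OwnedBy j).
Proof. by rewrite /=; case: j. Qed.

(** When the result of [j] is [o], an early double of the opponent either ends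
    the game with [- x] for [j], or hands the cube to [j], who then secures
    [D * o] at the end. *)
Lemma gain_ge_doubled n h : in_game h -> sign_of j * O = o ->
  [/\ o <= sign_of j * gain n (OwnedBy opp) h,
     o <= sign_of j * gain n (OwnedBy j) h,
     D * o <= sign_of j * gain n.+1 (OwnedBy j) h
   & D * o <= sign_of j * gain n.+2 Centered h].
Proof.
move=> + Oo; case: D_own => oD Dx Dy.
have own_of_opp m : (forall h, in_game h ->
      o <= sign_of j * gain m (OwnedBy opp) h) ->
    forall h, in_game h -> D * o <= sign_of j * gain m.+1 (OwnedBy j) h.
  move=> IH h' hg; have [[_ /(_ erefl)]//|[_ _ [h2 hg2 [->|->]]]|[/entitled_jF]//] :=
    gain_step m (OwnedBy j) hg.
    rewrite mulrCA; apply: (le_trans Dy); rewrite ler_pM2l//; exact: IH.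
  by rewrite sign_ofK.
(* In a game cut short before any proposal, j has not doubled yet and only o
   is guaranteed; with one proposal more, j secures D * o. *)
have base m : (forall h, in_game h ->
    o <= sign_of j * gain m (OwnedBy opp) h /\
    o <= sign_of j * gain m (OwnedBy j) h).
  elim: m => [|m IH] {}h hg; first by rewrite /= Oo.
  split; last first.
    by apply: (le_trans oD); apply: own_of_opp => // h' /IH[].
  have [[-> _]|[/entitled_oppF]//|[_ [h2 hg2 ->]]] := gain_step m (OwnedBy opp) hg.
    by rewrite Oo.
  case: ifPn => [/D_acc[oy _]|/D_fold[ox _ _ _]].
    rewrite mulrCA; apply: (le_trans oy); rewrite ler_pM2l//.
    by case: (IH h2 hg2).
  by rewrite mulrN sign_ofK.
have own m : forall h, in_game h -> D * o <= sign_of j * gain m.+1 (OwnedBy j) h.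
  by move=> h' hg; apply: own_of_opp hg => h2 hg2; have [] := base m h2 hg2.
move=> hg; have [b1 b2] := base n h hg; split => //; first exact: own.
have [[_ /(_ I)]//|[_ _ [h2 hg2 [->|->]]]|[_ [h2 hg2 ->]]] :=
    gain_step n.+1 Centered hg.
- rewrite mulrCA; apply: (le_trans Dy); rewrite ler_pM2l//.
  by have [] := base n.+1 h2 hg2.
- by rewrite sign_ofK.
- case: ifPn => [/D_acc[oy _]|/D_fold[_ Dx' _ _]].
    rewrite mulrCA; apply: (@le_trans _ _ (y * (D * o))).
      by rewrite mulrCA ler_wpM2l.
    by rewrite ler_pM2l//; exact: own.
  by rewrite mulrN sign_ofK.
Qed.

(** When the result of [j] is not [o], [j] never doubles, so the opponent, who
    does not get the cube back, doubles at most once. *)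
Lemma gain_ge_undoubled n c h : in_game h -> sign_of j * O <> o ->
  sign_of j * doubled_outcome D o c O <= sign_of j * gain n c h.
Proof.
move=> + Oo; case: D_own => oD Dx Dy.
have Ocases : sign_of j * O = - o \/ sign_of j * O = 0.
  have [[_ -> _]|[r [_ _ O1 _ _]]] := game_endP W0 Wc p01.
    by right; rewrite mulr0.
  left; case: o1 O1 Oo => -> [] ->; case: (j) => /=;
    rewrite ?mulr1 ?mulrN ?mul1r ?mulN1r ?opprK//.
have lowC : D * (sign_of j * O) <= sign_of j * O.
  by case: Ocases => ->; rewrite ?mulr0//; lra.
have own m : forall h, in_game h -> gain m (OwnedBy j) h = O.
  case: m => // m h' hg.
  by have [[]|[]|[/entitled_jF]] := gain_step m (OwnedBy j) hg.
have low m c' h' : in_game h' -> c' <> OwnedBy j ->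
    D * (sign_of j * O) <= sign_of j * gain m c' h'.
  case: m => // m hg c'j.
  have [[-> _]//|[_ /Oo]//|[_ [h2 hg2 ->]]] := gain_step m c' hg.
  case: ifPn => [/D_acc[oy yD]|/D_fold[ox Dxn nDx x0]].
    rewrite own// [leRHS]mulrCA; case: Ocases => ->; rewrite ?mulr0//; lra.
  by rewrite mulrN sign_ofK; case: Ocases => ->; rewrite ?mulr0//; lra.
case: c => [|i] hg /=; first by rewrite mulrCA; exact: low.
have [ij|ij] : i = j \/ i = opp by case: (i) (j) => -[]; [left|right|right|left].
  by subst i; rewrite own// ifF//; apply/eqP.
subst i; have := low n (OwnedBy opp) h hg; rewrite sign_of_opponent.
have nopp : OwnedBy opp <> OwnedBy j by case: (j).
move=> /(_ nopp); case: ifPn => [_|/eqP]; first by rewrite mulrCA.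
case: Ocases => Oc; rewrite mulNr Oc; first by rewrite opprK.
by rewrite !mulr0 oppr0.
Qed.

(** Two proposals are allowed for because from the centered cube the opponent
    may double first, and [j] only afterwards. *)
Lemma gain_ge_doubled_outcome n c :
  sign_of j * doubled_outcome D o c O <= sign_of j * gain n.+2 c [::].
Proof.
have hg : in_game [::] by split => //=; exact: (exit_time_ge0 W0 Wc p01).
have [Oo|Oo] := eqVneq (sign_of j * O) o; last exact/gain_ge_undoubled/eqP.
have [_ _ _ cen] := gain_ge_doubled n hg Oo.
case: c => [|i]; rewrite /doubled_outcome; first by rewrite mulrCA Oo.
have [ij|ij] : i = j \/ i = opp by case: (i) (j) => -[]; [left|right|right|left].
  subst i; rewrite Oo eqxx mulrCA Oo.
  by have [_ _ + _] := gain_ge_doubled n.+1 hg Oo.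
subst i; have [+ _ _ _] := gain_ge_doubled n.+2 hg Oo.
have /eqP/negbTE oN : - o <> o by case: o1 => ->; lra.
by rewrite sign_of_opponent mulNr Oo oN Oo.
Qed.

End SaddlePoint.

(** * Sampling a path on a grid *)

Definition grid_sum {R : realType} (f : R -> R) (h : R) (K : nat)
    (tau : \bar R) : R :=
  \sum_(k < K) (f (k.+1%:R * h) - f (k%:R * h)) *
    ((k.+1%:R * h)%:E < tau)%E%:R.

(** The increments over the cells that end before [tau] telescope to the value
    at the last grid point before [tau]. *)
Lemma grid_sumP {R : realType} (f : R -> R) (h : R) (K : nat) (tau : \bar R) :
  f 0 = 0 -> 0 <= h ->
  exists2 j, (j <= K)%N & [/\ grid_sum f h K tau = f (j%:R * h),
    j = 0%N \/ ((j%:R * h)%:E < tau)%E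
  & j = K \/ (tau <= (j.+1%:R * h)%:E)%E].
Proof.
move=> f0 h0; elim: K => [|K [j jK [gj jtau tauj]]].
  by exists 0%N => //; split; [rewrite /grid_sum big_ord0 mul0r|left|left].
rewrite /grid_sum big_ord_recr/= -/(grid_sum f h K tau) gj.
have [tauK|Ktau] := leP tau (K.+1%:R * h)%:E.
  exists j; first exact: leqW.
  split; [by rewrite mulr0 addr0|by []|].
  by case: tauj => [->|?]; right.
have jEK : j = K.
  case: tauj => // tauj; apply/eqP; rewrite eqn_leq jK/= leqNgt.
  apply/negP => ltjK; move: Ktau; rewrite ltNge (le_trans tauj)//.
  by rewrite lee_fin ler_wpM2r// ler_nat ltnW.
exists K.+1 => //; rewrite jEK; split; [|by right|by left].
by rewrite mulr1 addrC subrK.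
Qed.

(** The times [K n * h n] may tend to a limit as well as to infinity: the grid
    only has to reach the time r. *)
Lemma cvg_grid_sum {R : realType} (f : R -> R) (h : R^nat) (K : nat -> nat)
    (r : R) : f 0 = 0 -> 0 <= r ->
  (forall e, 0 < e -> exists2 del, 0 < del &
    forall s, 0 <= s -> `|s - r| < del -> `|f s - f r| < e) ->
  (forall n, 0 <= h n) -> h @ \oo --> 0 ->
  (\forall n \near \oo, r <= (K n)%:R * h n) ->
  grid_sum f (h n) (K n) r%:E @[n --> \oo] --> f r.
Proof.
move=> f0 r0 fc h0 hcvg Kh; apply/cvgrPdist_lt => e e0.
have [del del0 Hdel] := fc e e0.
have hdel : \forall n \near \oo, h n < del.
  move/cvgrPdist_lt : hcvg => /(_ del del0); apply: filterS => n.
  by rewrite sub0r normrN ger0_norm.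
apply: filterS2 hdel Kh => n hn Kn.
have [j jK [-> jr rj]] := @grid_sumP _ f (h n) (K n) r%:E f0 (h0 n).
have {}jr : j%:R * h n <= r.
  by case: jr => [->|]; [rewrite mul0r|rewrite lte_fin => /ltW].
rewrite distrC; apply: Hdel; first by rewrite mulr_ge0.
rewrite ler0_norm ?subr_le0// opprB.
case: rj => [jEK|]; first by move: jr; rewrite jEK; lra.
by rewrite lee_fin -natr1 mulrDl mul1r; lra.
Qed.

Lemma le_norm_pow4 {R : realFieldType} (e z : R) : 0 < e ->
  `|z| <= e + z ^+ 4 / e ^+ 3.
Proof.
move=> e0; have z40 : 0 <= z ^+ 4 by rewrite exprn_even_ge0.
have [ze|ez] := leP `|z| e; first by rewrite ler_wpDr// divr_ge0// exprn_ge0// ltW.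
rewrite ler_wpDl ?(ltW e0)// ler_pdivlMr ?exprn_gt0//.
have -> : z ^+ 4 = `|z| * `|z| ^+ 3 by rewrite -exprS -normrX ger0_norm.
by rewrite ler_wpM2l// lerXn2r ?nnegrE ?(ltW e0)// ltW.
Qed.

(** Unlike [grid_sum], it includes the increment over the cell that contains
    [tau]; whether a term is present is then known at the beginning of its
    cell. *)
Definition left_grid_sum {R : realType} (f : R -> R) (h : R) (K : nat)
    (tau : \bar R) : R :=
  \sum_(k < K) (f (k.+1%:R * h) - f (k%:R * h)) * ((k%:R * h)%:E < tau)%E%:R.

(** The two sums differ by at most one increment, which is bounded without
    knowing which one it is. *)
Lemma left_grid_sum_gap {R : realType} (f : R -> R) (h : R) (K : nat)
    (tau : \bar R) (e : R) : 0 <= h -> 0 < e ->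
  `|left_grid_sum f h K tau - grid_sum f h K tau| <=
    e + (\sum_(k < K) (f (k.+1%:R * h) - f (k%:R * h)) ^+ 4) / e ^+ 3.
Proof.
move=> h0 e0; pose c k : R := ((k%:R * h)%:E < tau)%E%:R.
pose D k := f (k.+1%:R * h) - f (k%:R * h).
have cS k : c k.+1 <= c k.
  rewrite /c ler_nat; case: ltP => // lt; rewrite (le_lt_trans _ lt)//.
  by rewrite lee_fin ler_wpM2r// ler_nat.
have -> : left_grid_sum f h K tau - grid_sum f h K tau =
    \sum_(k < K) D k * (c k - c k.+1).
  by rewrite -sumrB; apply: eq_bigr => k _; rewrite mulrBr.
apply: (le_trans (ler_norm_sum _ _ _)).
have le1 (k : 'I_K) : `|D k * (c k - c k.+1)| <= e * (c k - c k.+1) + D k ^+ 4 / e ^+ 3.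
  have ck1 : c k <= 1 by rewrite /c; case: (_ < _)%E.
  have ck0 : 0 <= c k.+1 by rewrite /c.
  have b0 : 0 <= c k - c k.+1 by rewrite subr_ge0.
  rewrite normrM (ger0_norm b0).
  have := ler_wpM2r b0 (le_norm_pow4 (D k) e0).
  have q0 : 0 <= D k ^+ 4 / e ^+ 3.
    by apply: divr_ge0; [exact: exprn_even_ge0|rewrite exprn_ge0// ltW].
  have : D k ^+ 4 / e ^+ 3 * (c k - c k.+1) <= D k ^+ 4 / e ^+ 3.
    by rewrite ler_piMr//; lra.
  by rewrite mulrDl; lra.
apply: (le_trans (ler_sum _ (fun k _ => le1 k))).
rewrite big_split/= -mulr_sumr -mulr_suml lerD2r.
(* The weights c k - c k.+1 telescope: at most one of them is 1. *)
rewrite (_ : \sum_(k < K) _ = c 0%N - c K).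
  by rewrite ler_piMr ?(ltW e0)// /c; case: (_ < _)%E; case: (_ < _)%E => /=; lra.
elim: K {le1} => [|K IH]; first by rewrite big_ord0 subrr.
by rewrite big_ord_recr/= IH; ring.
Qed.

(** * Integrals and normal laws *)

(** The integral is monotone even on functions that are not measurable, being a
    difference of suprema over simple functions. *)
Lemma le_integral_pointwise {d : measure_display} {T : measurableType d}
    {R : realType} (mu : {measure set T -> \bar R}) (f g : T -> \bar R) :
  (forall x, f x <= g x)%E -> (\int[mu]_x f x <= \int[mu]_x g x)%E.
Proof.
move=> fg; rewrite /integral; apply: leeB; apply: le_ereal_sup => _ [h hf <-];
  exists h => // t; apply: le_trans (hf t) _; rewrite !patch_setT.
- by rewrite !funeposE ge_max !le_max fg/= lexx orbT.
- by rewrite !funenegE ge_max !le_max leeN2 fg lexx orbT.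
Qed.

Lemma ge0_integral_mrestr {d : measure_display} {T : measurableType d}
    {R : realType} (mu : {measure set T -> \bar R}) (D : set T)
    (mD : measurable D) (f : T -> \bar R) :
  measurable_fun setT f -> (forall x, 0 <= f x)%E ->
  (\int[mrestr mu mD]_x f x = \int[mu]_(x in D) f x)%E.
Proof.
move=> mf f0; rewrite (@ge0_negligible_integral _ _ _ _ setT (~` D))//=; last 2 first.
- exact: measurableC.
- by rewrite /mrestr/= setICl measure0.
rewrite setDE setCK setTI; apply: eq_measure_integral => A mA AD.
by rewrite /= /mrestr setIidl.
Qed.

Section NormalMoments.
Context {R : realType}.
Implicit Types s a : R.

(** The density defining the normal law is its Radon-Nikodym derivative up to
    a null set, so a change of measure applies. *)
Lemma ge0_integral_normal_prob (m s : R) (f : R -> \bar R) :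
  measurable_fun setT f -> (forall x, 0 <= f x)%E ->
  (\int[normal_prob m s]_x f x =
   \int[lebesgue_measure]_x (f x * (normal_pdf m s x)%:E))%E.
Proof.
move=> mf f0; have dom := normal_prob_dominates m s.
pose g := Radon_Nikodym_SigmaFinite.f (normal_prob m s) (@lebesgue_measure R).
rewrite -(Radon_Nikodym_SigmaFinite.change_of_variables dom f0)// -/g.
have ig : lebesgue_measure.-integrable setT g.
  exact: (Radon_Nikodym_SigmaFinite.f_integrable dom).
have mpdf : measurable_fun setT (fun x => (normal_pdf m s x)%:E).
  by apply/measurable_EFinP; exact: measurable_normal_pdf.
apply: ae_eq_integral => //.
- by apply: emeasurable_funM => //; exact: measurable_int ig.
- exact: emeasurable_funM.
- apply: ae_eqe_mul2l; apply: integral_ae_eq => // E _ mE.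
  by rewrite -(Radon_Nikodym_SigmaFinite.f_integral dom mE).
Qed.

(** Completing the square turns [exp (a x)] times a centered normal density
    into a constant times a shifted one. *)
Lemma normal_expR s a : s != 0 ->
  (\int[normal_prob 0 s]_x (expR (a * x))%:E =
   (expR (a ^+ 2 * s ^+ 2 / 2))%:E)%E.
Proof.
move=> s0; have me : measurable_fun setT (fun x : R => (expR (a * x))%:E).
  by apply/measurable_EFinP; exact: measurableT_comp.
rewrite ge0_integral_normal_prob//.
transitivity (\int[lebesgue_measure]_x ((expR (a ^+ 2 * s ^+ 2 / 2))%:E *
    (normal_pdf (a * s ^+ 2) s x)%:E))%E.
  apply: eq_integral => x _; rewrite !normal_pdfE// -!EFinM; congr EFin.
  rewrite mulrCA [RHS]mulrCA; congr (_ * _).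
  by rewrite /normal_fun -!expRD; congr expR; field.
rewrite integralZl//; last exact: integrable_normal_pdf.
by rewrite integral_normal_pdf mule1.
Qed.

Lemma expr4_le_expR (z : R) : z ^+ 4 <= 24 * (expR z + expR (- z)).
Proof.
have H (u : R) : 0 <= u -> u ^+ 4 <= 24 * expR u.
  move=> u0; have /= := expR_ge1Dxn 3 u0.
  rewrite (_ : 4`! = 24%N)// => h.
  have : u ^+ 4 / 24 <= expR u by apply: le_trans h; rewrite lerDr.
  by rewrite ler_pdivrMr// mulrC.
have [z0|z0] := leP 0 z.
  by rewrite (le_trans (H z z0))// ler_pM2l// lerDl expR_ge0.
have zN : z ^+ 4 = (- z) ^+ 4 by ring.
rewrite zN (le_trans (H (- z) _))//; first by rewrite oppr_ge0 ltW.
by rewrite ler_pM2l// lerDr expR_ge0.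
Qed.

Lemma normal_prob_itv_le (s : R) : 0 < s ->
  (normal_prob 0 s [set` `[-1, 1]%R] <= (2 / s)%:E)%E.
Proof.
move=> s0; have sn0 : s != 0 by rewrite gt_eqF.
rewrite /normal_prob; apply: (@le_trans _ _
    (\int[lebesgue_measure]_(x in [set` `[-1, 1]%R]) (normal_peak s)%:E)%E).
  apply: ge0_le_integral => //.
  - by move=> x _; rewrite lee_fin normal_pdf_ge0.
  - apply/measurable_EFinP/measurable_funTS; exact: measurable_normal_pdf.
  - by move=> x _; rewrite lee_fin normal_pdf_ub.
rewrite integral_cst//= lebesgue_measure_itv/= lte_fin ifT; last by lra.
rewrite -EFinB -EFinM lee_fin opprK [1 + 1](_ : _ = 2)// mulrC ler_pM2l//.
rewrite /normal_peak lef_pV2 ?posrE//; last first.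
  by rewrite sqrtr_gt0 pmulrn_lgt0// mulr_gt0 ?pi_gt0// exprn_gt0.
have -> : s = Num.sqrt (s ^+ 2) by rewrite sqrtr_sqr gtr0_norm.
rewrite ler_sqrt ?sqr_sqrtr ?sqr_ge0//.
  by rewrite -mulrnAr ler_peMr ?sqr_ge0//; have := pi_ge2 R; lra.
by rewrite mulrn_wge0// mulr_ge0 ?sqr_ge0// pi_ge0.
Qed.

End NormalMoments.

(** * Stopping times *)

Lemma ge0_le_nat {R : realType} (t : \bar R) : (0 <= t)%E ->
  t = +oo%E \/ exists n : nat, (t <= n%:R%:E)%E.
Proof.
case: t => [r| |]//; last by left.
rewrite lee_fin => r0; right; exists (Num.bound r).
by rewrite lee_fin ltW// archi_boundP.
Qed.

Section Brownian.
Context {d : measure_display} {Omega : measurableType d} {R : realType}.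
Variables (F : R -> set (set Omega)).
Hypothesis HF : filtration F.

(** Viewing [F t] as the measurable sets of a type gives access to the theory
    of measurable functions relative to the information at time t. *)
Lemma filtration_measurable t (A : set Omega) : 0 <= t ->
  measurable (A : set (g_sigma_algebraType (F t))) <-> F t A.
Proof.
move=> t0; case: HF => [/(_ t t0) Ft _ _].
by rewrite -[X in _ <-> X A](sigma_algebra_id Ft).
Qed.

Lemma filtration_event (t : R) (A : set Omega) : 0 <= t -> F t A -> measurable A.
Proof. by move=> t0; case: HF => [_ + _]; apply. Qed.

Lemma filtration_sub s t A : 0 <= s -> s <= t -> F s A -> F t A.
Proof. by move=> s0 st; case: HF => [_ _ sub]; exact: sub. Qed.

Lemma filtrationC t A : 0 <= t -> F t A -> F t (~` A).
Proof.
move=> t0 /(filtration_measurable A t0) mA.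
by apply/filtration_measurable => //; exact: measurableC.
Qed.

Lemma filtrationI t A B : 0 <= t -> F t A -> F t B -> F t (A `&` B).
Proof.
move=> t0 /(filtration_measurable A t0) mA /(filtration_measurable B t0) mB.
by apply/filtration_measurable => //; exact: measurableI.
Qed.

Lemma filtrationU t A B : 0 <= t -> F t A -> F t B -> F t (A `|` B).
Proof.
move=> t0 /(filtration_measurable A t0) mA /(filtration_measurable B t0) mB.
by apply/filtration_measurable => //; exact: measurableU.
Qed.

Lemma stopping_time_min (sigma tau : Omega -> \bar R) :
  stopping_time F sigma -> stopping_time F tau ->
  stopping_time F (fun w => mine (sigma w) (tau w)).
Proof.
move=> [s0 sF] [t0 tF]; split => [w|t tge]; first by rewrite le_min s0 t0.
rewrite [X in F t X](_ : _ =
  [set w | (sigma w <= t%:E)%E] `|` [set w | (tau w <= t%:E)%E]).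
  by apply: filtrationU => //; [exact: sF|exact: tF].
by apply/seteqP; split => w /=; rewrite ge_min => /orP.
Qed.

Lemma stopping_time_cst (t : \bar R) : (0 <= t)%E ->
  stopping_time F (fun=> t).
Proof.
move=> t0; split => // s s0; apply/(filtration_measurable _ s0).
have [ts|ts] := boolP (t <= s%:E)%E.
  by rewrite [X in measurable X](_ : _ = setT)//; apply/seteqP.
by rewrite [X in measurable X](_ : _ = set0)//; apply/seteqP;
  split => w //=; rewrite (negbTE ts).
Qed.

Lemma stopping_time_if (tau : Omega -> \bar R) (b : Omega -> bool) :
  (forall w, (0 <= tau w)%E) ->
  (forall t, 0 <= t -> F t [set w | (tau w <= t%:E)%E /\ b w]) ->
  stopping_time F (fun w => if (tau w < +oo)%E && b w then tau w else +oo%E).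
Proof.
move=> tau0 Ftau; split => [w|t t0]; first by case: ifP.
rewrite [X in F t X](_ : _ = [set w | (tau w <= t%:E)%E /\ b w]); first exact: Ftau.
apply/seteqP; split => w /=.
  by case: ifP => [/andP[]|_]; rewrite ?leye_eq.
by move=> [taut bw]; rewrite bw (le_lt_trans taut) ?ltry.
Qed.

Lemma stopping_time_event (tau : Omega -> \bar R) (t : R) :
  stopping_time F tau -> 0 <= t -> measurable [set w | (tau w <= t%:E)%E].
Proof. by move=> [_ tauF] t0; apply: (filtration_event t0); exact: tauF. Qed.

Lemma stopping_time_never (tau : Omega -> \bar R) :
  stopping_time F tau -> measurable [set w | tau w = +oo%E].
Proof.
move=> stau; have [tau0 _] := stau.
rewrite (_ : [set w | _] = ~` \bigcup_n [set w | (tau w <= n%:R%:E)%E]).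
  apply: measurableC; apply: bigcupT_measurable => n.
  exact: stopping_time_event.
apply/seteqP; split => w /= => [too [n _] /=|ntau]; first by rewrite too leye_eq.
have [//|[n taun]] := ge0_le_nat (tau0 w).
by exfalso; apply: ntau; exists n.
Qed.

(** A function that is known at a stopping time, and constant where that time
    is infinite, is a random variable. *)
Lemma measurable_stopped (tau : Omega -> \bar R) (f : Omega -> R) (c : R) :
  stopping_time F tau ->
  (forall t B, 0 <= t -> measurable B ->
    F t [set w | (tau w <= t%:E)%E /\ B (f w)]) ->
  (forall w, tau w = +oo%E -> f w = c) -> measurable_fun setT f.
Proof.
move=> stau Ff foo _ B mB; rewrite setTI; have [tau0 _] := stau.
have ftaun (n : nat) := filtration_event (ler0n R n) (Ff n%:R B (ler0n R n) mB).
rewrite [X in measurable X](_ : _ =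
  (\bigcup_n [set w | (tau w <= n%:R%:E)%E /\ B (f w)]) `|`
  ([set w | tau w = +oo%E] `&` [set _ | B c])).
  apply: measurableU; first exact: bigcupT_measurable.
  apply: measurableI; first exact: stopping_time_never.
  have [Bc|nBc] := pselect (B c).
    by rewrite [X in measurable X](_ : _ = setT)//; apply/seteqP; split.
  by rewrite [X in measurable X](_ : _ = set0)//; apply/seteqP; split.
apply/seteqP; split => w /=.
  have [too|[n taun_w]] := ge0_le_nat (tau0 w); last by left; exists n.
  by rewrite (foo _ too) => Bc; right.
by move=> [[n _ []//]|[too Bc]]; rewrite (foo _ too).
Qed.

Lemma rlatest_stopping (rh : random_history) : stopping_history F rh ->
  stopping_time F (rlatest rh).
Proof.
by case: rh => [_|[k tau] rh [stau _ _]//] /=; exact: stopping_time_cst.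
Qed.

Lemma latest_realize (rh : random_history) (w : Omega) :
  latest (realize rh w) = fine (rlatest rh w) :> R.
Proof. by case: rh => [|[]]. Qed.

Variables (P : probability Omega R) (sigma : R) (W : R -> Omega -> R).
Hypothesis HW : brownian_motion P F sigma W.

Let W0 w : W 0 w = 0. Proof. by case: HW. Qed.

Let Wc w : {within `[0, +oo[, continuous (fun t => W t w)}.
Proof. by case: HW. Qed.

(** * The Brownian motion at a stopping time *)

Lemma adapted_measurable s t : 0 <= s -> s <= t ->
  measurable_fun (setT : set (g_sigma_algebraType (F t))) (W s).
Proof.
move=> s0 st _ B mB; rewrite setTI.
apply/(filtration_measurable _ (le_trans s0 st)).
by apply: filtration_sub st _ => //; case: HW => [_ _ + _]; apply.
Qed.

Lemma grid_sum_measurable (tau : Omega -> \bar R) (h : R) (K : nat) (t : R) :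
  stopping_time F tau -> 0 <= h -> K%:R * h <= t ->
  measurable_fun (setT : set (g_sigma_algebraType (F t)))
    (fun w => grid_sum (W ^~ w) h K (tau w)).
Proof.
move=> [_ tauF] h0 Kt; rewrite /grid_sum.
apply: measurable_sum => k.
have kt : k.+1%:R * h <= t.
  by apply: le_trans Kt; rewrite ler_wpM2r// ler_nat.
have kt' : k%:R * h <= t.
  by apply: le_trans kt; rewrite ler_wpM2r// ler_nat.
have k0 : 0 <= k.+1%:R * h by rewrite mulr_ge0.
apply: measurable_funM.
  by apply: measurable_funB; apply: adapted_measurable => //; rewrite mulr_ge0.
pose A := ~` [set w | (tau w <= (k.+1%:R * h)%:E)%E].
rewrite [X in measurable_fun _ X](_ : _ = \1_A); last first.
  apply/funext => w; rewrite indicE; congr (nat_of_bool _)%:R.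
  apply/idP/idP => [lt_tau|]; rewrite inE /A /= leNgt; first by rewrite lt_tau.
  by move=> /negP; rewrite negbK.
apply: measurable_indic.
apply/(filtration_measurable _ (le_trans k0 kt)).
apply: filtrationC; first exact: le_trans kt.
by apply: filtration_sub kt _ => //; exact: tauF.
Qed.

(** On the event that [tau] has occurred by time t, the state at [tau] is a
    limit of grid sums over [0, t], all of them known at time t. *)
Lemma stopped_value_measurable (tau : Omega -> \bar R) (t : R) :
  stopping_time F tau -> 0 <= t ->
  measurable_fun
    ([set w | (tau w <= t%:E)%E] : set (g_sigma_algebraType (F t)))
    (fun w => W (fine (tau w)) w).
Proof.
move=> stau t0; apply: (@measurable_fun_cvg _ (g_sigma_algebraType (F t)) R _
  (fun n w => grid_sum (W ^~ w) (t / n.+1%:R) n.+1 (tau w))) => [n|w /= taut].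
  apply: measurable_funTS; apply: grid_sum_measurable => //.
    by rewrite divr_ge0.
  by rewrite mulrC divfK.
have [tau0 _] := stau.
have [r tauE] : exists r, tau w = r%:E.
  by move: taut (tau0 w); case: (tau w) => // r; exists r.
move: taut (tau0 w); rewrite tauE !lee_fin/= => rt r0.
apply: cvg_grid_sum => //.
- by move=> e e0; exact: (path_continuousP (@Wc w) r0 e0).
- by move=> n; rewrite divr_ge0.
- rewrite -(mulr0 t); apply: cvgM; [exact: cvg_cst|exact: cvg_harmonic].
- by near=> n; rewrite mulrC divfK.
Unshelve. all: by end_near. Qed.

Lemma stopped_value_filtration (tau : Omega -> \bar R) (t : R) (B : set R) :
  stopping_time F tau -> 0 <= t -> measurable B ->
  F t [set w | (tau w <= t%:E)%E /\ B (W (fine (tau w)) w)].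
Proof.
move=> stau t0 mB; have [_ tauF] := stau.
apply/(filtration_measurable _ t0).
apply: (stopped_value_measurable stau t0) => //.
by apply/(filtration_measurable _ t0); exact: tauF.
Qed.

(** * Moments of the increments *)

Hypothesis sigma0 : 0 < sigma.

Lemma measurable_state (t : R) : 0 <= t -> measurable_fun setT (W t).
Proof.
move=> t0 _ B mB; rewrite setTI; apply: (filtration_event t0).
by case: HW => [_ _ + _]; apply.
Qed.

Section Increment.
Variables (s t : R).
Hypotheses (s0 : 0 <= s) (st : s < t).

Local Notation D := (fun w => (W t w - W s w)%R).
Local Notation sd := (sigma * Num.sqrt (t - s)).

Let t0 : 0 <= t. Proof. exact: le_trans (ltW st). Qed.

Let sd_gt0 : 0 < sd.
Proof. by rewrite mulr_gt0// sqrtr_gt0 subr_gt0. Qed.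

Let measurable_increment : measurable_fun setT D.
Proof. by apply: measurable_funB; exact: measurable_state. Qed.

Lemma ge0_integral_increment (A : set Omega) (f : R -> \bar R) : F s A ->
  measurable_fun setT f -> (forall x, 0 <= f x)%E ->
  (\int[P]_(w in A) f (W t w - W s w)%R =
   P A * \int[normal_prob 0 sd]_x f x)%E.
Proof.
move=> FA mf f0; have mA := filtration_event s0 FA.
have PA : P A = (fine (P A))%:E by rewrite fineK// fin_num_measure.
have PA0 : 0 <= fine (P A) by exact: fine_ge0.
have mfD : measurable_fun setT (f \o D) by exact: measurableT_comp.
rewrite -(@ge0_integral_mrestr _ _ _ P _ mA (f \o D) mfD); last by move=> w /=.
(* Both sides integrate f against a measure on the line, and the two
   measures agree by the independence of the increment. *)
pose law : {measure set (measurableTypeR R) -> \bar R} :=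
  pushforward (mrestr P mA) (D : Omega -> measurableTypeR R).
pose law' : {measure set (measurableTypeR R) -> \bar R} :=
  mscale (NngNum PA0) (normal_prob 0 sd).
pose mu := law measurable_increment.
have lawE B : measurable B -> B `<=` setT -> mu B = law' B.
  move=> mB _; rewrite /= /pushforward /mrestr /mscale /= -PA setIC.
  by case: HW => _ _ _ ->.
transitivity (\int[mu]_x f x)%E.
  exact/esym/(@ge0_integral_pushforward _ _ Omega (measurableTypeR R)).
transitivity (\int[law']_x f x)%E; first exact: eq_measure_integral.
by rewrite PA (ge0_integral_mscale _ _ (NngNum PA0)).
Qed.

Lemma integral_increment_expR (a : R) (A : set Omega) : F s A ->
  (\int[P]_(w in A) (expR (a * (W t w - W s w)))%:E =
   P A * (expR (a ^+ 2 * (sigma ^+ 2 * (t - s)) / 2))%:E)%E.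
Proof.
move=> FA; rewrite (@ge0_integral_increment A (fun x => (expR (a * x))%:E))//.
- by rewrite normal_expR ?gt_eqF// exprMn sqr_sqrtr// subr_ge0 ltW.
- by apply/measurable_EFinP; exact: measurableT_comp.
Qed.

(** The exponential moments at plus and minus the inverse of the standard
    deviation dominate the fourth moment. *)
Lemma integral_increment_pow4 :
  (\int[P]_w ((W t w - W s w) ^+ 4)%:E <=
   (48 * expR (2^-1) * sigma ^+ 4 * (t - s) ^+ 2)%:E)%E.
Proof.
have FT : F s setT.
  by apply/(filtration_measurable _ s0); exact: measurableT.
have mexp a : measurable_fun setT (fun w => (expR (a * D w))%:E).
  apply/measurable_EFinP; apply: measurableT_comp => //.
  exact: measurable_funM.
apply: (@le_trans _ _ (\int[P]_w ((24 * sd ^+ 4)%:E *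
    ((expR (sd^-1 * D w))%:E + (expR (- sd^-1 * D w))%:E))))%E.
  apply: ge0_le_integral => //.
  - by move=> w _; rewrite lee_fin exprn_even_ge0.
  - by apply/measurable_EFinP; exact: measurable_funX.
  - by apply: emeasurable_funM => //; exact: emeasurable_funD.
  move=> w _; rewrite -EFinD -EFinM lee_fin mulrAC mulNr mulrC.
  have := expr4_le_expR (sd^-1 * D w); rewrite exprMn exprVn.
  by rewrite ler_pdivrMl// exprn_gt0.
rewrite ge0_integralZl_EFin//; last 3 first.
- by move=> w _; rewrite -EFinD lee_fin addr_ge0 ?expR_ge0.
- exact: emeasurable_funD.
- by rewrite mulr_ge0// exprn_ge0// ltW.
rewrite ge0_integralD// !integral_increment_expR// probability_setT !mul1e.
have sd2 : sd ^+ 2 = sigma ^+ 2 * (t - s).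
  by rewrite exprMn sqr_sqrtr// subr_ge0 ltW.
have half (a : R) : a ^+ 2 = (sd ^+ 2)^-1 ->
    a ^+ 2 * (sigma ^+ 2 * (t - s)) / 2 = 2^-1.
  by move=> ->; rewrite -sd2 mulVf ?mul1r// gt_eqF// exprn_gt0.
rewrite !half ?sqrrN ?exprVn// -EFinD -EFinM lee_fin.
rewrite (_ : sd ^+ 4 = sigma ^+ 4 * (t - s) ^+ 2); last first.
  by rewrite (exprM _ 2 2) sd2; ring.
by move: (expR _) => E; rewrite le_eqVlt; apply/orP; left; apply/eqP; ring.
Qed.

Lemma integrable_increment : P.-integrable setT (fun w => (W t w - W s w)%:E).
Proof.
have m4 : measurable_fun setT (fun w => ((D w) ^+ 4)%:E).
  by apply/measurable_EFinP; exact: measurable_funX.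
have i4 : P.-integrable setT (fun w => ((D w) ^+ 4)%:E).
  apply/integrableP; split => //.
  under eq_integral do rewrite gee0_abs ?lee_fin ?exprn_even_ge0//.
  exact: le_lt_trans integral_increment_pow4 (ltry _).
have i1 : P.-integrable setT (fun=> 1%:E : \bar R).
  exact: finite_measure_integrable_cst.
apply: (le_integrable measurableT _ _ (integrableD measurableT i1 i4)).
  exact/measurable_EFinP.
move=> w _; rewrite -EFinD !abse_EFin lee_fin.
have D40 : 0 <= D w ^+ 4 by rewrite exprn_even_ge0.
rewrite [leRHS]ger0_norm ?addr_ge0//.
have [D1|D1] := leP `|D w| 1; first by lra.
have : `|D w| <= `|D w| ^+ 4 by rewrite -[leLHS]expr1 ler_weXn2l// ltW.
by rewrite -normrX [`|D w ^+ 4|]ger0_norm//; lra.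
Qed.

(** The mean r of the increment over [A] satisfies [a * r <= C * a ^ 2] for
    all small a of either sign, by comparison with the exponential moments. *)
Lemma integral_increment0 (A : set Omega) : F s A ->
  (\int[P]_(w in A) (W t w - W s w)%:E = 0)%E.
Proof.
move=> FA; have mA := filtration_event s0 FA.
have iA : P.-integrable A (fun w => (D w)%:E).
  exact: integrableS integrable_increment.
have finI : (\int[P]_(w in A) (D w)%:E)%E \is a fin_num.
  exact: integrable_fin_num.
set r := fine (\int[P]_(w in A) (D w)%:E)%E.
have rE : (\int[P]_(w in A) (D w)%:E = r%:E)%E by rewrite fineK.
pose q := fine (P A).
have qE : P A = q%:E by rewrite fineK// fin_num_measure.
have q0 : 0 <= q by exact: fine_ge0.
have q1 : q <= 1 by rewrite -lee_fin -qE probability_le1.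
pose v := sigma ^+ 2 * (t - s).
have v0 : 0 <= v by rewrite mulr_ge0 ?sqr_ge0// subr_ge0 ltW.
(* The bound 1 + aD <= exp (aD), integrated over A. *)
have bound a : a * r + q <= q * expR (a ^+ 2 * v / 2).
  have mexp : measurable_fun A (fun w => (expR (a * D w))%:E).
    apply: measurable_funTS; apply/measurable_EFinP; apply: measurableT_comp => //.
    exact: measurable_funM.
  have iexp : P.-integrable A (fun w => (expR (a * D w))%:E).
    apply/integrableP; split => //.
    under eq_integral do rewrite gee0_abs ?lee_fin ?expR_ge0//.
    by rewrite integral_increment_expR// qE -EFinM ltry.
  rewrite -lee_fin EFinD !EFinM -qE -integral_increment_expR// -rE.
  have i1 : P.-integrable A (fun=> 1%:E : \bar R).
    exact: finite_measure_integrable_cst.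
  rewrite -integralZl// -[P A]mul1e -integral_cst// -integralD//; last first.
    exact: integrableZl.
  apply: le_integral => //; first by apply: integrableD => //; exact: integrableZl.
  move=> w _ /=; rewrite -EFinM -EFinD lee_fin addrC; exact: expR_ge1Dx.
have small (a : R) : `|a| <= 1 -> a * r <= a ^+ 2 * (v / 2 * expR (v / 2)).
  move=> a1; set u := a ^+ 2 * v / 2.
  have u0 : 0 <= u by rewrite divr_ge0// mulr_ge0// sqr_ge0.
  have uv : u <= v / 2.
    rewrite /u -mulrA ler_piMl ?divr_ge0// -real_normK ?num_real//.
    by rewrite exprn_ile1.
  have e1 : expR u - 1 <= u * expR u.
    have := expR_ge1Dx (- u); rewrite expRN => h.
    have : (1 - u) * expR u <= 1.
      by rewrite -ler_pdivlMr ?expR_gt0// div1r.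
    by lra.
  have e2 : a * r <= expR u - 1.
    have /= := bound a; rewrite -/u => h.
    have : q * (expR u - 1) <= expR u - 1.
      by rewrite ler_piMl// subr_ge0 -expR0 ler_expR.
    by lra.
  apply: le_trans e2 (le_trans e1 _).
  rewrite (_ : a ^+ 2 * _ = u * expR (v / 2)); last by rewrite /u; ring.
  by rewrite ler_wpM2l// ler_expR.
(* If r were nonzero, a = r / M would give M <= K, against the choice of M. *)
rewrite rE; congr EFin; apply/eqP/negPn/negP => r0.
pose K := v / 2 * expR (v / 2).
have K0 : 0 <= K by rewrite mulr_ge0 ?expR_ge0// divr_ge0.
pose M := `|r| + K + 1.
have M0 : 0 < M by rewrite ltr_wpDl// addr_ge0.
have rM : `|r / M| <= 1.
  by rewrite normrM normfV (gtr0_norm M0) ler_pdivrMr// mul1r /M; lra.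
have := small _ rM; rewrite -/K.
have r2 : 0 < r ^+ 2 by rewrite exprn_even_gt0.
have -> : r / M * r = r ^+ 2 / M ^+ 2 * M by field; rewrite gt_eqF.
rewrite expr_div_n ler_pM2l; last by rewrite divr_gt0// exprn_gt0.
by rewrite leNgt /M; have := normr_ge0 r; lra.
Qed.

End Increment.

(** * Optional stopping *)

(** Whether a cell begins before [tau] is known when the cell begins, so each
    term is an increment integrated over an event of its own past. *)
Lemma integral_left_grid_sum (tau : Omega -> \bar R) (h : R) (K : nat) :
  stopping_time F tau -> 0 < h ->
  P.-integrable setT (fun w => (left_grid_sum (W ^~ w) h K (tau w))%:E) /\
  (\int[P]_w (left_grid_sum (W ^~ w) h K (tau w))%:E = 0)%E.
Proof.
move=> [tau0 tauF] h0.
pose A k := ~` [set w | (tau w <= (k%:R * h)%:E)%E].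
have kh0 k : 0 <= k%:R * h by rewrite mulr_ge0// ltW.
have khS k : k%:R * h < k.+1%:R * h by rewrite ltr_pM2r// ltr_nat.
have FA k : F (k%:R * h) (A k) by apply: filtrationC => //; exact: tauF.
have mA k : measurable (A k) by exact: (filtration_event (kh0 k)).
pose D k w := W (k.+1%:R * h) w - W (k%:R * h) w.
have iD k : P.-integrable setT (fun w => (D k w)%:E).
  exact: integrable_increment.
pose f k w := ((fun w => (D k w)%:E) \_ (A k)) w.
have sumE w : (left_grid_sum (W ^~ w) h K (tau w))%:E = (\sum_(k < K) f k w)%E.
  rewrite /left_grid_sum -sumEFin; apply: eq_bigr => k _.
  rewrite /f patchE; have [At|At] := boolP (w \in A k).
    by move: At; rewrite inE /A /= leNgt => /negP; rewrite negbK => ->; rewrite mulr1.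
  move: At; rewrite notin_setE /A /= => /contrapT; rewrite leNgt => /negbTE ->.
  by rewrite mulr0.
have if_ k : P.-integrable setT (f k).
  apply/(integrable_mkcond _ (mA k)); exact: integrableS (iD k).
split; first by under eq_fun do rewrite sumE; exact: integrable_sum.
under eq_integral do rewrite sumE.
rewrite (@integral_sum _ _ _ P setT _ _ (fun k : 'I_K => f k))//.
apply: big1 => k _; rewrite -integral_mkcond.
exact: integral_increment0.
Qed.

Lemma measurable_grid_sum (tau : Omega -> \bar R) (h : R) (K : nat) :
  stopping_time F tau -> 0 <= h ->
  measurable_fun setT (fun w => grid_sum (W ^~ w) h K (tau w)).
Proof.
move=> stau h0 _ B mB.
have Kh : 0 <= K%:R * h by rewrite mulr_ge0.
have := grid_sum_measurable stau h0 (lexx (K%:R * h)) (@measurableT _ _) mB.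
by rewrite !setTI => /(filtration_measurable _ Kh); exact: (filtration_event Kh).
Qed.

(** A grid sum has almost mean zero, being close in mean to the left grid
    sum. *)
Lemma integral_grid_sum_le (tau : Omega -> \bar R) (h e : R) (K : nat) :
  stopping_time F tau -> 0 < h -> 0 < e ->
  P.-integrable setT (fun w => (grid_sum (W ^~ w) h K (tau w))%:E) ->
  (`| \int[P]_w (grid_sum (W ^~ w) h K (tau w))%:E | <=
   (e + K%:R * (48 * expR (2^-1) * sigma ^+ 4 * h ^+ 2) / e ^+ 3)%:E)%E.
Proof.
move=> stau h0 e0 iG; have [iL L0] := integral_left_grid_sum K stau h0.
pose G w := grid_sum (W ^~ w) h K (tau w).
pose L w := left_grid_sum (W ^~ w) h K (tau w).
have kh0 k : 0 <= k%:R * h by rewrite mulr_ge0// ltW.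
have khS k : k%:R * h < k.+1%:R * h by rewrite ltr_pM2r// ltr_nat.
pose D k w := W (k.+1%:R * h) w - W (k%:R * h) w.
have mD4 k : measurable_fun setT (fun w => (D k w ^+ 4)%:E).
  apply/measurable_EFinP; apply: measurable_funX.
  by apply: measurable_funB; apply: measurable_state.
have E1 : (`| \int[P]_w (G w)%:E | = `| \int[P]_w ((L w)%:E - (G w)%:E) |)%E.
  by rewrite integralB// L0 sub0e abseN.
rewrite [X in (`|X|)%E](_ : _ = \int[P]_w (G w)%:E)%E// {}E1.
have iB := integrableB measurableT iL iG.
apply: (le_trans (le_abse_integral _ measurableT (measurable_int _ iB))).
pose bound w := (e%:E + (e ^- 3)%:E * \sum_(k < K) (D k w ^+ 4)%:E)%E.
have sum0 w : (0 <= \sum_(k < K) (D k w ^+ 4)%:E)%E.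
  by apply: sume_ge0 => k _; rewrite lee_fin exprn_even_ge0.
have e30 : 0 <= e ^- 3 by rewrite invr_ge0 exprn_ge0// ltW.
have msum : measurable_fun setT (fun w => \sum_(k < K) (D k w ^+ 4)%:E)%E.
  by apply: emeasurable_sum => k.
apply: (@le_trans _ _ (\int[P]_w bound w)%E).
  apply: ge0_le_integral => //.
  - by apply: measurableT_comp => //; exact: measurable_int iB.
  - by apply: emeasurable_funD => //; exact: emeasurable_funM.
  - move=> w _; rewrite -EFinB abse_EFin /bound sumEFin -EFinM -EFinD lee_fin.
    by rewrite [_ ^- 3 * _]mulrC; apply: left_grid_sum_gap => //; exact: ltW.
rewrite ge0_integralD//; last 3 first.
- by move=> w _; rewrite lee_fin ltW.
- by move=> w _; rewrite mule_ge0.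
- exact: emeasurable_funM.
rewrite integral_cst// [X in (_ * X + _)%E](_ : _ = 1%E); last exact: probability_setT.
rewrite mule1 ge0_integralZl_EFin//.
rewrite ge0_integral_sum//; last by move=> k w _; rewrite lee_fin exprn_even_ge0.
rewrite EFinD leeD2l// [in X in (_ <= X)%E]mulrC EFinM lee_pmul2l//; last first.
  by rewrite lte_fin invr_gt0 exprn_gt0.
have step (k : 'I_K) : (\int[P]_w (D k w ^+ 4)%:E <=
    (48 * expR (2^-1) * sigma ^+ 4 * h ^+ 2)%:E)%E.
  have := integral_increment_pow4 (kh0 k) (khS k).
  have -> : k.+1%:R * h - k%:R * h = h by rewrite -natr1; ring.
  by [].
apply: (le_trans (lee_sum _ (fun k _ => step k))).
by rewrite sumEFin sumr_const card_ord -[_ *+ K]mulr_natl lexx.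
Qed.

Section Position.
Variable p0 : R.
Hypothesis p01 : 0 <= p0 <= 1.

Local Notation T := (exit_time W p0).

Let interior_at (a s : R) : set Omega :=
  [set w | a <= p0 + W s w <= 1 - a].

(** By compactness, a state that stays inside the unit interval up to time t
    stays away from 0 and 1; by continuity this can be tested at the rational
    times and at t. *)
Let exit_gtP t w : 0 <= t ->
  (t%:E < T w)%E <->
  exists m, forall q : rat, interior_at m.+1%:R^-1 (Num.min t `|ratr q|) w.
Proof.
move=> t0; split=> [tT|[m hm]]; last first.
  have a0 : 0 < m.+1%:R^-1 :> R by rewrite invr_gt0.
  move: (m.+1%:R^-1) hm a0 => a hm a0.
  have near_in s : 0 <= s <= t -> interior_at a s w.
    move=> /andP[s0 st].
    have near_s e : 0 < e -> exists2 u, interior_at a u w & `|W u w - W s w| < e.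
      move=> e0; have [del del0 Hdel] := path_continuousP (@Wc w) s0 e0.
      have [tsE|ts] := eqVneq s t.
        exists s; last by rewrite subrr normr0.
        have [q tq _] : exists2 q : rat, t < ratr q & ratr q < t + 1.
          have [q] := @rat_in_itvoo _ t (t + 1) ltac:(by rewrite ltrDl).
          by rewrite in_itv/= => /andP[h1 h2]; exists q.
        have := hm q; rewrite min_l ?tsE// ger0_norm ?ltW//.
        exact: le_lt_trans tq.
      have {}ts : s < t by rewrite lt_neqAle ts.
      have [q] := @rat_in_itvoo _ s (Num.min t (s + del))
        ltac:(by rewrite lt_min ts ltrDl).
      rewrite in_itv/= lt_min => /and3P[sq qt qs].
      have q0 : 0 <= ratr q :> R by rewrite ltW// (le_lt_trans s0).
      exists (ratr q).
        by have := hm q; rewrite ger0_norm// min_r// ltW.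
      by apply: Hdel => //; rewrite ger0_norm; lra.
    rewrite /interior_at/=; apply/andP; split; rewrite leNgt; apply/negP => h.
      have [|u /andP[u1 u2]] := near_s (a - (p0 + W s w)); first by rewrite subr_gt0.
      by rewrite ltr_norml => /andP[]; lra.
    have [|u /andP[u1 u2]] := near_s (p0 + W s w - (1 - a)); first by rewrite subr_gt0.
    by rewrite ltr_norml => /andP[]; lra.
  have [[-> _]|[r [r0 Tr end01 _]]] := exit_timeP (W0 w) (@Wc w) p01.
    exact: ltry.
  rewrite Tr lte_fin ltNge; apply/negP => rt.
  have := near_in r; rewrite r0 rt => /(_ isT) /andP[].
  by case: end01 => ->; lra.
have in01 s : 0 <= s -> s <= t -> 0 < p0 + W s w < 1.
  move=> s0 st; have [[_ h]|[r [r0 Tr _ h]]] := exit_timeP (W0 w) (@Wc w) p01.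
    exact: h.
  by apply: h => //; rewrite -lte_fin -Tr (le_lt_trans _ tT).
have pc : {within `[0, t], continuous (fun s => W s w)}.
  apply: continuous_subspaceW (@Wc w) => s /=.
  by rewrite !in_itv/= => /andP[->].
have [c1 + minc] := EVT_min t0 pc; have [c2 + maxc] := EVT_max t0 pc.
rewrite !in_itv/= => /andP[c20 c2t] /andP[c10 c1t].
have gap0 : 0 < Num.min (p0 + W c1 w) (1 - (p0 + W c2 w)).
  have /andP[h1 _] := in01 c1 c10 c1t; have /andP[_ h2] := in01 c2 c20 c2t.
  by rewrite lt_min h1 subr_gt0.
have [m _ hm] := near_infty_natSinv_lt (PosNum gap0).
exists m => q; have qt : Num.min t `|ratr q| \in `[0, t].
  by rewrite in_itv/= le_min t0 normr_ge0/= ge_min lexx.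
have := hm m (leqnn m); rewrite /= lt_min => /andP[h1 h2].
have := minc _ qt; have := maxc _ qt; rewrite /interior_at/=.
move: (_^-1) h1 h2 => a h1 h2 h3 h4; apply/andP; split; lra.
Qed.

Lemma exit_time_stopping : stopping_time F T.
Proof.
split => [w|t t0]; first exact: exit_time_ge0.
rewrite [X in F t X](_ : _ = ~` \bigcup_m ~` \bigcup_(q : rat)
  ~` interior_at m.+1%:R^-1 (Num.min t `|ratr q|)); last first.
  apply/seteqP; split => w /=.
    rewrite leNgt => /negP ntT [m _] /= h; apply: ntT; apply/exit_gtP => //.
    by exists m => q; apply: contrapT => nh; apply: h; exists q.
  move=> h; rewrite leNgt; apply/negP => /(exit_gtP w t0)[m hm].
  by apply: h; exists m => // -[q _]; apply; exact: hm.
apply/(filtration_measurable _ t0); apply: measurableC.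
apply: bigcupT_measurable => m; apply: measurableC.
apply: bigcupT_measurable_rat => q; apply: measurableC.
set s := Num.min _ _.
have s0 : 0 <= s by rewrite le_min t0 normr_ge0.
have st : s <= t by rewrite ge_min lexx.
have mWs := adapted_measurable s0 st.
move: (m.+1%:R^-1) => a.
have m01 : measurable `[a - p0, 1 - a - p0].
  exact: measurable_itv.
have := mWs (@measurableT _ _) _ m01.
rewrite setTI; congr (measurable _); apply/seteqP; split => w /=;
  rewrite /interior_at /= in_itv/= => /andP[h1 h2]; apply/andP; split; lra.
Qed.

(** The law of the state at time t spreads out as t grows, so the state
    cannot remain in the unit interval with positive probability. *)
Lemma exit_never_null : P [set w | T w = +oo%E] = 0.
Proof.
have mN := stopping_time_never exit_time_stopping.
(* At time (n + 1) ^ 2 the standard deviation is sigma * (n + 1). *)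
have le_n n : (P [set w | T w = +oo%E] <= (2 / (sigma * n.+1%:R))%:E)%E.
  have n0 : 0 < n.+1%:R :> R by [].
  have FT : F 0 setT by apply/(filtration_measurable _ (lexx 0)); exact: measurableT.
  have [_ _ _ indep] := HW.
  have mB : measurable (`[-1, 1]%classic : set R) by exact: measurable_itv.
  have := indep 0 (n.+1%:R ^+ 2) setT _ (lexx 0) (exprn_gt0 2 n0) FT mB.
  rewrite subr0 sqrtr_sqr gtr0_norm// setTI.
  rewrite [X in (X * _)%E](_ : _ = 1%E) ?mul1e => [PE|]; last exact: probability_setT.
  apply: (le_trans _ (normal_prob_itv_le (mulr_gt0 sigma0 n0))).
  rewrite -PE; apply: le_measure; rewrite ?inE//.
    have mW := measurable_state (exprn_ge0 2 (ltW n0)).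
    have mW0 := measurable_state (lexx 0).
    by have := measurable_funB mW mW0 (@measurableT _ _) mB; rewrite setTI.
  move=> w /= Too.
  have [[_ h]|[r [_ Tr _ _]]] := exit_timeP (W0 w) (@Wc w) p01; last first.
    by rewrite Tr in Too.
  have := h (n.+1%:R ^+ 2) (exprn_ge0 2 (ltW n0)).
  rewrite in_itv/= W0 subr0.
  by move: p01 => /andP[? ?] /andP[? ?]; apply/andP; split; lra.
apply/eqP; rewrite eq_le measure_ge0// andbT.
have lim0 : (2 / (sigma * n.+1%:R))%:E @[n --> \oo] --> (0 : \bar R).
  apply: cvg_EFin; first by near=> n.
  rewrite (_ : _ \o _ = (fun n => 2 / sigma * harmonic n)).
    rewrite -[X in _ --> X](mulr0 (2 / sigma)).
    by apply: cvgM; [exact: cvg_cst|exact: cvg_harmonic].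
  by apply/funext => n /=; rewrite invfM mulrA.
rewrite -(cvg_lim _ lim0)//; apply: lime_ge; first by apply/cvg_ex; exists 0%E.
by near=> n; exact: le_n.
Unshelve. all: by end_near. Qed.

Lemma stopped_state_le1 (S : \bar R) w : (0 <= S)%E -> (S <= T w)%E ->
  `|W (fine S) w| <= 1.
Proof.
move=> S0 ST; case: S S0 ST => [r| |]//=; last by rewrite W0 normr0.
rewrite lee_fin => r0 rT.
have := game_state01 (W0 w) (@Wc w) p01 r0; rewrite game_state_before//.
by move: p01 => /andP[? ?] /andP[? ?]; rewrite ler_norml; apply/andP; split; lra.
Qed.

(** As [S] does not exceed the exit time, the grid sums are values taken inside
    the unit interval; they are therefore bounded, and dominated convergence
    applies. *)
Lemma optional_stopping (S : Omega -> \bar R) :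
  stopping_time F S -> (forall w, (S w <= T w)%E) ->
  P.-integrable setT (fun w => (W (fine (S w)) w)%:E) /\
  (\int[P]_w (W (fine (S w)) w)%:E = 0)%E.
Proof.
move=> sS ST; have [S0 _] := sS.
have mWS : measurable_fun setT (fun w => W (fine (S w)) w).
  apply: (measurable_stopped (c := 0) sS) => [t B t0 mB|w ->/=]; last exact: W0.
  exact: (stopped_value_filtration sS t0 mB).
have i1 : P.-integrable setT (fun=> 1%:E : \bar R).
  exact: finite_measure_integrable_cst.
have iWS : P.-integrable setT (fun w => (W (fine (S w)) w)%:E).
  apply: (le_integrable measurableT _ _ i1); first exact/measurable_EFinP.
  by move=> w _; rewrite !abse_EFin lee_fin normr1; exact: stopped_state_le1.
split => //.
(* The mesh h = e ^ 5 with K * h = 1 / e exhausts the half-line and makes the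
   error e + K * C * h ^ 2 / e ^ 3 equal to (1 + C) * e. *)
pose e n : R := n.+1%:R^-1.
have e0 n : 0 < e n by rewrite invr_gt0.
pose h n := e n ^+ 5.
have h0 n : 0 < h n by rewrite exprn_gt0.
pose K n := (n.+1 ^ 6)%N.
have Kh n : (K n)%:R * h n = n.+1%:R.
  rewrite /K /h /e natrX exprVn exprS mulfK// expf_neq0// pnatr_eq0.
pose G n w := grid_sum (W ^~ w) (h n) (K n) (S w).
have mG n : measurable_fun setT (G n).
  by apply: measurable_grid_sum => //; exact: ltW.
have G1 n w : `|G n w| <= 1.
  rewrite /G; have [j _ [-> jS _]] :=
    @grid_sumP _ (W ^~ w) (h n) (K n) (S w) (W0 w) (ltW (h0 n)).
  case: jS => [->|jS]; first by rewrite mul0r W0 normr0.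
  apply: (@stopped_state_le1 (_)%:E); first by rewrite lee_fin mulr_ge0// ltW.
  exact: le_trans (ltW jS) (ST w).
have iG n : P.-integrable setT (fun w => (G n w)%:E).
  apply: (le_integrable measurableT _ _ i1); first exact/measurable_EFinP.
  by move=> w _; rewrite !abse_EFin lee_fin normr1; exact: G1.
have cvgG w : T w <> +oo%E -> G n w @[n --> \oo] --> W (fine (S w)) w.
  move=> Tfin; rewrite /G; case: (S w) (S0 w) (ST w) => [r r0 rT|/=|]//; last first.
    by rewrite leye_eq => _ /eqP.
  apply: cvg_grid_sum => //.
  - by move=> u u0; exact: (path_continuousP (@Wc w) r0 u0).
  - by move=> n; exact: ltW.
  - apply: (@squeeze_cvgr _ _ _ _ (fun=> 0) e); last 2 first.
    + exact: cvg_cst.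
    + exact: cvg_harmonic.
    near=> n; rewrite ltW//= /h exprS ler_piMr ?(ltW (e0 n))//.
    by rewrite exprn_ile1 ?(ltW (e0 n))// /e invf_le1// ler1n.
  - exists (Num.bound r) => // n /= rn; rewrite Kh.
    by rewrite (le_trans (ltW (archi_boundP r0)))// ler_nat leqW.
have aeG : {ae P, forall w, setT w ->
    (G n w)%:E @[n --> \oo] --> (W (fine (S w)) w)%:E}.
  exists [set w | T w = +oo%E]; split.
  - exact: stopping_time_never exit_time_stopping.
  - exact: exit_never_null.
  - move=> w /= nG; apply: contrapT => Tfin; apply: nG => _.
    by apply: cvg_EFin; [near=> n|exact: cvgG].
have [_ _ cvgI] := @dominated_convergence _ _ _ P setT measurableT
  (fun n w => (G n w)%:E) (fun w => (W (fine (S w)) w)%:E) (fun=> 1%:E)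
  (fun n => (measurable_EFinP _ _).2 (mG n)) ((measurable_EFinP _ _).2 mWS)
  aeG i1 ltac:(by apply: aeW => w n _; rewrite abse_EFin lee_fin; exact: G1).
pose C := 48 * expR (2^-1) * sigma ^+ 4.
have boundI n : (`| \int[P]_w (G n w)%:E | <= ((1 + C) * e n)%:E)%E.
  apply: (le_trans (integral_grid_sum_le sS (h0 n) (e0 n) (iG n))).
  rewrite lee_fin -/C le_eqVlt; apply/orP; left; apply/eqP.
  rewrite mulrDl mul1r; congr (_ + _).
  have -> : (K n)%:R * (C * h n ^+ 2) / e n ^+ 3 =
      C * ((K n)%:R * h n) * (h n / e n ^+ 3) by ring.
  have -> : h n / e n ^+ 3 = e n ^+ 2.
    by rewrite /h (exprD _ 2 3) mulfK// expf_neq0// gt_eqF.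
  have en : n.+1%:R * e n = 1 by rewrite /e mulfV// pnatr_eq0.
  by rewrite Kh expr2 mulrA -(mulrA C) en mulr1.
have I0 : (\int[P]_w (G n w)%:E)%E @[n --> \oo] --> (0 : \bar R)%E.
  apply/cvg_abse0P.
  apply: (@squeeze_cvge _ _ _ _ (fun=> 0%E) _ (fun n => ((1 + C) * e n)%:E)).
  - by near=> n; rewrite abse_ge0 boundI.
  - exact: cvg_cst.
  - apply: cvg_EFin; first by near=> n.
    rewrite -[X in _ --> X](mulr0 (1 + C)).
    by apply: cvgM; [exact: cvg_cst|exact: cvg_harmonic].
exact: (cvg_unique _ cvgI I0).
Unshelve. all: by end_near. Qed.

Lemma integral_stop_to_exit (S : Omega -> \bar R) : stopping_time F S ->
  P.-integrable setT
    (fun w => (W (fine (T w)) w - W (fine (mine (S w) (T w))) w)%:E) /\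
  (\int[P]_w (W (fine (T w)) w - W (fine (mine (S w) (T w))) w)%:E = 0)%E.
Proof.
move=> sS; have sT := exit_time_stopping.
have [iT T0] := optional_stopping sT (fun w => lexx (T w)).
have sM := stopping_time_min sS sT.
have [iM M0] := optional_stopping sM
  (fun w => ltac:(by rewrite ge_min lexx orbT)).
split; first by under eq_fun do rewrite EFinB; exact: integrableB.
by under eq_integral do rewrite EFinB; rewrite integralB// T0 M0 subee.
Qed.

(** * The strategies do not anticipate *)

Lemma stopped_game_state_filtration (tau : Omega -> \bar R) (t : R) (B : set R) :
  stopping_time F tau -> 0 <= t -> measurable B ->
  F t [set w | (tau w <= t%:E)%E /\ B (game_state W p0 (fine (tau w)) w)].
Proof.
move=> stau t0 mB; have [tau0 tauF] := stau.
pose S w := mine (tau w) (T w).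
have sS : stopping_time F S.
  by apply: stopping_time_min => //; exact: exit_time_stopping.
have mpB : measurable [set v | B (p0 + v)].
  have mp : measurable_fun setT (fun v : R => p0 + v) by exact: measurable_funD.
  by have := mp (@measurableT _ _) B mB; rewrite setTI.
have := filtrationI t0 (tauF t t0) (stopped_value_filtration sS t0 mpB).
congr (F t _); apply/seteqP; split => w /=.
  move=> [taut [_]]; rewrite /game_state /S fineK//.
  by rewrite ge0_fin_numE// (le_lt_trans taut) ?ltry.
move=> [taut]; rewrite /game_state fineK; last first.
  by rewrite ge0_fin_numE// (le_lt_trans taut) ?ltry.
by split => //; split => //; rewrite /S ge_min taut.
Qed.

Lemma stopping_time_accepted (tau : Omega -> \bar R) (b : R -> bool) :
  stopping_time F tau -> measurable [set q | b q] ->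
  stopping_time F (fun w =>
    if (tau w < +oo)%E && b (game_state W p0 (fine (tau w)) w)
    then tau w else +oo%E).
Proof.
move=> stau mb; apply: stopping_time_if => [w|t t0]; first by case: stau.
exact: (stopped_game_state_filtration stau t0 mb).
Qed.

Lemma measurable_evaluation (i : player) :
  measurable_fun setT (evaluation i : R -> R).
Proof.
case: i => /=; first exact: measurable_id.
by apply: (@measurable_funB _ _ _ _ (cst 1) id).
Qed.

Lemma strategy_of_admissible (rule : doubling_rule) (acc : R -> bool) (i : player) :
  measurable [set q | acc q] ->
  (forall h w, ((latest h)%:E <= rule p0 i h w)%E) ->
  (forall rh, stopping_history F rh -> stopping_time F (fun w =>
     if (rlatest rh w < +oo)%E then rule p0 i (realize rh w) w else +oo%E)) ->
  admissible F (strategy_of W rule acc p0 i).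
Proof.
move=> macc rule_ge rule_st; split => // k tau rh [stau _ _] /=.
apply: (@stopping_time_accepted tau (fun q => acc (evaluation i q))) => //.
by have := measurable_evaluation i (@measurableT _ _) macc; rewrite setTI.
Qed.

Lemma never_double_admissible (acc : R -> bool) (i : player) :
  measurable [set q | acc q] ->
  admissible F (strategy_of W (@never_double _ Omega R) acc p0 i).
Proof.
move=> macc; apply: strategy_of_admissible => // [h w|rh _].
  exact: leey.
rewrite [X in stopping_time _ X](_ : _ = fun=> +oo%E); first exact: stopping_time_cst.
by apply/funext => w; case: ifP.
Qed.

Lemma exit_outcome_filtration (t : R) (B : set R) : 0 <= t -> measurable B ->
  F t [set w | (T w <= t%:E)%E /\ B (outcome W p0 w)].
Proof.
move=> t0 mB.
have sT : stopping_time F T by exact: exit_time_stopping.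
have mf : measurable_fun setT (fun v : R => 2 * (p0 + v) - 1).
  by apply: measurable_funB => //; apply: measurable_funM => //;
    exact: measurable_funD.
have mfB := mf (@measurableT _ _) B mB; rewrite setTI in mfB.
have := stopped_value_filtration sT t0 mfB.
congr (F t _); apply/seteqP; split => w /= [Tt]; split => //.
  by rewrite (outcome_exit (W0 w) (@Wc w) p01)// (le_lt_trans Tt) ?ltry.
by rewrite -(outcome_exit (W0 w) (@Wc w) p01)// (le_lt_trans Tt) ?ltry.
Qed.

Lemma double_at_admissible (o : R) (acc : R -> bool) (i : player) :
  o = 1 \/ o = -1 -> measurable [set q | acc q] ->
  admissible F (strategy_of W (double_at W ((1 + o) / 2)) acc p0 i).
Proof.
move=> o1 macc; apply: strategy_of_admissible => // [h w|rh srh].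
  by apply: le_ereal_inf_tmp => _ [u /= [lu _] <-]; rewrite lee_fin.
have [L0 LF] := rlatest_stopping srh.
pose b w := sign_of i * outcome W p0 w == o.
pose M w := maxe (rlatest rh w) (T w).
rewrite [X in stopping_time _ X](_ : _ = fun w =>
  if (M w < +oo)%E && b w then M w else +oo%E); last first.
  apply/funext => w; rewrite /M gt_max; case: ifPn => //= Loo.
  have Lfin : (rlatest rh w \is a fin_num) by rewrite ge0_fin_numE.
  rewrite (double_atE (W0 w) (@Wc w) p01) ?latest_realize ?fineK ?fine_ge0//.
  rewrite -/(b w); have [_|] := boolP (b w); last by rewrite andbF.
  rewrite andbT; case: ifPn => //; rewrite -leNgt leye_eq => /eqP ->.
  by rewrite max_r ?leey.
apply: stopping_time_if => [w|t t0]; first by rewrite le_max L0.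
have mB : measurable [set q : R | sign_of i * q == o].
  rewrite (_ : [set q | _] = [set sign_of i * o]); first exact: measurable_set1.
  apply/seteqP; split => q /=; first by move=> /eqP <-; rewrite sign_ofK.
  by move=> ->; rewrite sign_ofK.
have := filtrationI t0 (LF t t0) (exit_outcome_filtration t0 mB).
congr (F t _); apply/seteqP; split => w /=; rewrite /M ge_max.
  by move=> [-> [-> bw]].
by move=> [/andP[-> ->] bw].
Qed.

(** * Doubling at the end of the game *)

Lemma measurable_outcome : measurable_fun setT (outcome W p0).
Proof.
apply: (measurable_stopped (c := 0) exit_time_stopping) => [t B|w Too].
  exact: exit_outcome_filtration.
have [[_ //]|[r [_ Tr _ _ _]]] := game_endP (W0 w) (@Wc w) p01.
by rewrite Tr in Too.
Qed.

Lemma doubled_outcome_integrable (D o : R) (c : cube) (i : player) : 0 <= D ->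
  P.-integrable setT
    (fun w => (sign_of i * doubled_outcome D o c (outcome W p0 w))%:E).
Proof.
move=> D0; apply: measurable_bounded_integrable => //.
- exact: (le_lt_trans (probability_le1 P measurableT) (ltry _)).
- have md : measurable_fun setT (doubled_outcome D o c).
    have mDq : measurable_fun setT (fun q : R => D * q).
      by apply: (@measurable_funM _ _ _ _ (cst D) id).
    case: c => [|k] //; apply: measurable_fun_ifT => //.
    apply: (measurable_fun_bool true).
    rewrite setTI [X in measurable X](_ : _ = [set sign_of k * o]).
      exact: measurable_set1.
    apply/seteqP; split => q /=; first by move=> /eqP <-; rewrite sign_ofK.
    by move=> ->; rewrite sign_ofK eqxx.
  apply: measurable_funM => //; apply: (measurableT_comp md).
  exact: measurable_outcome.
- exists (D + 1); split; first exact: num_real.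
  move=> M DM w _ /=; rewrite normrM.
  have -> : `|sign_of i| = 1 :> R by case: (i); rewrite /= ?normrN normr1.
  rewrite mul1r; apply: le_trans (ltW DM).
  have O1 := outcome_norm_le1 (W0 w) (@Wc w) p01.
  have DO1 : `|D * outcome W p0 w| <= D by rewrite normrM ger0_norm// ler_piMr.
  by case: c => [|k] /=; [|case: ifP => _]; lra.
Qed.

Variables (x y : R) (tie : player).
Hypothesis y0 : 0 < y.

Section DoubleAt.
Variables (D o : R) (b : bool).
Hypothesis o1 : o = 1 \/ o = -1.
Hypothesis D0 : 0 <= D.
Hypothesis D_own : [/\ o <= D * o, D * o <= x & D * o <= y * o].
Hypothesis D_acc : b -> o <= y * o /\ y * o <= D * o.
Hypothesis D_fold :
  ~~ b -> [/\ o <= - x, D * o <= - x, - (D * o) <= - x & 0 <= - x].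

Lemma payoff_ge_doubled_outcome (c : cube) (j : player)
    (s : player -> @strategy d Omega R) (w : Omega) :
  s j = strategy_of W (double_at W ((1 + o) / 2)) (fun=> b) p0 j ->
  admissible F (s (opponent j)) ->
  ((sign_of j * doubled_outcome D o c (outcome W p0 w))%:E <=
   payoff W p0 x y tie s c j w)%E.
Proof.
move=> sj [sopp _ _]; apply: payoff_ge => // n.
exact: (gain_ge_doubled_outcome tie (W0 w) (@Wc w) p01 y0 o1 D0 D_own D_acc D_fold sj).
Qed.

(** The pathwise lower bounds of the two players are opposite to each other:
    they are equalities when both follow the rule, and the bound of one player
    limits what a deviation brings the other. *)
Lemma double_at_equilibrium (c : cube) :
  equilibrium P F W p0 x y tie c
    (strategy_of W (double_at W ((1 + o) / 2)) (fun=> b) p0).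
Proof.
set s := strategy_of _ _ _ _.
have mb : measurable [set q : R | b].
  by case: (b); [rewrite (_ : [set q | _] = setT)|rewrite (_ : [set q | _] = set0)];
    rewrite //; apply/seteqP; split.
have adm i : admissible F (s i) by exact: double_at_admissible.
have payE i w : payoff W p0 x y tie s c i w =
    (sign_of i * doubled_outcome D o c (outcome W p0 w))%:E.
  apply/eqP; rewrite eq_le payoff_ge_doubled_outcome// andbT.
  have := @payoff_ge_doubled_outcome c (opponent i) s w erefl.
  rewrite payoff_opponent sign_of_opponent mulNr EFinN leeN2; apply.
  exact: adm.
split => // [i|i s' adm'].
  by rewrite (funext (payE i)); exact: doubled_outcome_integrable.
rewrite /expected_payoff leeNl.
under eq_integral do rewrite payE.
rewrite -integralN; last exact/integrable_add_def/doubled_outcome_integrable.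
apply: le_integral_pointwise => w; rewrite -EFinN -mulNr -sign_of_opponent.
apply: payoff_ge_doubled_outcome => //; first by case: (i).
have -> : deviate s i s' (opponent (opponent i)) = s' by case: (i).
exact: adm'.
Qed.

End DoubleAt.

(** * Never doubling *)

Hypothesis x0 : x < 0.
Hypothesis xy : 1 < - x \/ 1 < y.

(** For a responder whose evaluation is [q], the undoubled game is worth
    [1 - 2 * q] to the proposer: accepting costs y times this, folding costs
    [x]. *)
Definition accept_if_cheaper (q : R) : bool := y * (1 - 2 * q) <= x.

Local Notation acc := accept_if_cheaper.

Lemma measurable_accept_if_cheaper : measurable [set q | acc q].
Proof.
have mf : measurable_fun setT (fun q : R => y * (1 - 2 * q)).
  have m2 : measurable_fun setT (fun q : R => 1 - 2 * q) by exact: measurable_funB.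
  exact: measurable_funM.
have := mf (@measurableT _ _) _ (measurable_itv `]-oo, x]%R).
by rewrite setTI; congr (measurable _); apply/seteqP; split => q /=; rewrite in_itv.
Qed.

Local Notation standard := (strategy_of W (@never_double _ Omega R) acc p0).

Section Deviation.
Variables (i : player) (s' : @strategy d Omega R) (c : cube).
Hypothesis adm' : admissible F s'.

Local Notation s := (deviate standard i s').
Local Notation j := (opponent i).

(** After the first proposal of [i] the cube belongs to the opponent, who never
    proposes, so the first proposal is the only one; it is +oo if the cube
    belongs to the opponent from the start. *)
Definition only_proposal (w : Omega) : \bar R :=
  match c with
  | OwnedBy k => if player_eqb k i then propose s' [::] w else +oo%E
  | Centered => propose s' [::] w
  end.

Local Notation tau := only_proposal.

Lemma only_proposal_stopping : stopping_time F tau.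
Proof.
have st : stopping_time F (propose s' [::]).
  case: adm' => _ /(_ [::] I) + _; rewrite /=.
  by under eq_fun do rewrite ltry.
rewrite /tau; case: c => [|k] //; case: player_eqb => //.
exact: stopping_time_cst.
Qed.

Definition accepted w := acc (evaluation j (game_state W p0 (fine (tau w)) w)).

Lemma standard_never_proposes h w : propose (s j) h w = +oo%E.
Proof. by case: i. Qed.

Lemma gain_upto_opponent n h w :
  gain_upto W p0 x y tie s n (OwnedBy j) h w = outcome W p0 w.
Proof.
case: n => [|n] //.
have [[]//|[k [-> koo _ _]]] := gain_uptoSP W p0 x y tie s w n (OwnedBy j) h.
by rewrite standard_never_proposes ltxx in koo.
Qed.

Lemma gain_upto_deviation n w : gain_upto W p0 x y tie s n.+1 c [::] w =
  if (tau w < +oo)%E && (tau w <= T w)%E then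
    if accepted w then y * outcome W p0 w else sign_of i * x
  else outcome W p0 w.
Proof.
have si h : propose (s i) h w = propose s' h w by case: i.
have [[-> none]|[k [ck koo kT ->]]] := gain_uptoSP W p0 x y tie s w n c [::].
  case: ifPn => // /andP[]; rewrite /tau; case: c none => [none t1 t2|k none].
    by exfalso; apply: (none i I); rewrite si.
  case: ifPn => // ki t1 t2; exfalso; apply: (none i _); last by rewrite si.
  by case: (i) (k) ki => -[].
have ki : k = i.
  have : k = i \/ k = j by case: (i) (k) => -[]; [left|right|right|left].
  by move=> [//|kj]; move: koo; rewrite kj standard_never_proposes.
subst k; have tauE : tau w = propose (s i) [::] w.
  by rewrite si /tau; case: c ck => // _ <-; case: (i).
rewrite tauE koo kT/= /accepted tauE.
have -> : accept (s j) = accept (standard j) by case: i.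
by rewrite gain_upto_opponent.
Qed.

Lemma payoff_deviation w : payoff W p0 x y tie s c j w =
  (- (sign_of i * if (tau w < +oo)%E && (tau w <= T w)%E then
    if accepted w then y * outcome W p0 w else sign_of i * x
  else outcome W p0 w))%:E.
Proof.
rewrite (payoff_eventually j (fun n => gain_upto_deviation n.+1 w)).
by rewrite sign_of_opponent mulNr.
Qed.

(* The time of the proposal if the response is b, and +oo otherwise. *)
Let stop_if (b : bool) w :=
  if (tau w < +oo)%E && (accepted w == b) then tau w else +oo%E.

Lemma stop_if_stopping b : stopping_time F (stop_if b).
Proof.
have mb : measurable [set q : R | acc (evaluation j q) == b].
  have mj := measurable_evaluation j (@measurableT _ _) measurable_accept_if_cheaper.
  rewrite setTI in mj; case: b.
    by rewrite (_ : [set q | _] = evaluation j @^-1` [set q | acc q])//;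
      apply/seteqP; split => q /= /eqP.
  rewrite (_ : [set q | _] = ~` (evaluation j @^-1` [set q | acc q])).
    exact: measurableC.
  by apply/seteqP; split => q /=; [move=> /eqP ->|move=> /negP/negbTE ->].
exact: (stopping_time_accepted (b := fun q => acc (evaluation j q) == b)
  only_proposal_stopping mb).
Qed.

(* It vanishes unless a proposal is made in time and receives the response b;
   it is then half the change, from the proposal to the end, of the value of
   the undoubled game to Player A.  Its mean is zero by optional stopping. *)
Let V b w := W (fine (T w)) w - W (fine (mine (stop_if b w) (T w))) w.

(* When the game ends, this bounds the payoff of i from above; its mean is that
   of the result q of i in the undoubled game.  It equals q without a proposal,
   y * q - (y - 1) * m after an accepted one and m after one folded to, where m
   is the value to i of the undoubled game at the proposal. *)
Let U w := sign_of i * outcome W p0 w +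
  (2 * (y - 1) * sign_of i * V true w + - 2 * sign_of i * V false w).

(** Let m, between -1 and 1, be the value of the undoubled game to [i] at the
    proposal.  Acceptance means [y * m <= x < 0]; then 1 <= y, directly or
    because [- y <= y * m <= x < -1], so that [(y - 1) * m <= 0].  Folding means
    [x < y * m]; then [x <= m], because x is below 0, or below -1, or else m is
    negative and [y * m <= m]. *)
Lemma payoff_deviation_le w : (T w < +oo)%E ->
  ((- U w)%:E <= payoff W p0 x y tie s c j w)%E.
Proof.
move=> Too; rewrite payoff_deviation lee_fin lerN2 /U.
have OE := outcome_exit (W0 w) (@Wc w) p01 Too.
have [tau0 _] := only_proposal_stopping.
have V0 b : ~~ ((tau w < +oo)%E && (tau w <= T w)%E && (accepted w == b)) ->
    V b w = 0.
  rewrite /V /stop_if; case: ifPn => [/andP[t1 ->]|_ _].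
    by rewrite t1 andbT/= -ltNge => /ltW Tt; rewrite min_r// subrr.
  by rewrite min_r ?leey// subrr.
case: ifPn => [/andP[t1 t2]|nG]; last first.
  by rewrite !V0 ?(negbTE nG)//; lra.
have Vt : V (accepted w) w = W (fine (T w)) w - W (fine (tau w)) w.
  by rewrite /V /stop_if t1 eqxx/= min_l.
have V0' : V (~~ accepted w) w = 0.
  by apply: V0; case: accepted; rewrite andbF.
set u := fine (tau w) in Vt.
have tauu : tau w = u%:E by rewrite fineK// ge0_fin_numE.
have u0 : 0 <= u by rewrite -lee_fin -tauu.
have gsE : game_state W p0 u w = p0 + W u w.
  by rewrite game_state_before// -tauu.
pose m := sign_of i * (2 * (p0 + W u w) - 1).
have m1 : -1 <= m <= 1.
  have := game_state01 (W0 w) (@Wc w) p01 u0; rewrite gsE /m.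
  by case: (i) => /= /andP[h1 h2]; apply/andP; split; lra.
have accE : accepted w = (y * m <= x).
  rewrite /accepted -/u gsE /acc /m; congr (_ <= _).
  by case: (i) => /=; ring.
have Om : sign_of i * (2 * (W (fine (T w)) w - W u w)) =
    sign_of i * outcome W p0 w - m.
  by rewrite OE /m; ring.
clearbody m; move: Vt V0'; case: ifPn => [a Vt V0'|a Vt V0'].
  have ym : y * m <= x by rewrite -accE.
  rewrite V0' Vt.
  have le0 : (y - 1) * m <= 0.
    have m_lt0 : m < 0 by rewrite -(pmulr_rlt0 _ y0); exact: le_lt_trans ym x0.
    have : - y <= y * m by rewrite -mulrN1 ler_pM2l//; case/andP: m1.
    by rewrite nmulr_lle0//; case: xy; lra.
  rewrite mulr0 addr0 (_ : _ * _ * _ * _ = (y - 1) *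
    (sign_of i * (2 * (W (fine (T w)) w - W u w)))); last by ring.
  by rewrite Om; move: (sign_of i) (outcome _ _ _) le0 => si o le0; lra.
have xym : x < y * m by rewrite ltNge -accE.
rewrite V0' Vt mulr0 add0r sign_ofK.
rewrite (_ : - 2 * sign_of i * _ =
  - (sign_of i * (2 * (W (fine (T w)) w - W u w)))); last by ring.
rewrite Om addrC opprB subrK; have [m0|m0] := leP 0 m.
  exact: le_trans (ltW x0) m0.
case: xy => h.
  by case/andP: m1 => m1 _; apply: le_trans m1; rewrite lerNr ltW.
by apply: le_trans (ltW xym) _; rewrite ger_nMl ?ltW.
Qed.

Lemma integral_le_deviation :
  (- (\int[P]_w payoff W p0 x y tie s c j w) <=
   \int[P]_w (sign_of i * outcome W p0 w)%:E)%E.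
Proof.
have iO : P.-integrable setT (fun w => (sign_of i * outcome W p0 w)%:E).
  have := doubled_outcome_integrable 0 Centered i ler01.
  by rewrite /=; under eq_fun do rewrite mul1r.
have iV b : P.-integrable setT (fun w => (V b w)%:E).
  by have [] := integral_stop_to_exit (stop_if_stopping b).
have V0 b : (\int[P]_w (V b w)%:E = 0)%E.
  by have [] := integral_stop_to_exit (stop_if_stopping b).
pose k1 := 2 * (y - 1) * sign_of i; pose k2 : R := - 2 * sign_of i.
have iVV : P.-integrable setT
    (fun w => (k1%:E * (V true w)%:E + k2%:E * (V false w)%:E)%E).
  by apply: integrableD => //; exact: integrableZl.
have UE w : (U w)%:E = ((sign_of i * outcome W p0 w)%:E +
    (k1%:E * (V true w)%:E + k2%:E * (V false w)%:E))%E.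
  by rewrite -!EFinM -!EFinD.
have iU : P.-integrable setT (fun w => (U w)%:E).
  by under eq_fun do rewrite UE; exact: integrableD.
have intU : (\int[P]_w (U w)%:E = \int[P]_w (sign_of i * outcome W p0 w)%:E)%E.
  under eq_integral do rewrite UE.
  rewrite integralD// [X in (_ + X)%E](_ : _ = 0%E) ?adde0//.
  rewrite integralD//; [|exact: integrableZl|exact: integrableZl].
  by rewrite !integralZl// !V0 !mule0 adde0.
rewrite -intU leeNl -integralN; last exact: integrable_add_def.
(* The bound by - U may fail on the null event that the game never ends; -oo is
   put there, to have a bound valid everywhere, which needs no measurability
   of the payoff of the deviation. *)
pose B w := if T w == +oo%E then -oo%E else (- U w)%:E.
have mU : measurable_fun setT (fun w => (- (U w)%:E)%E).
  by apply: measurableT_comp => //; exact: measurable_int iU.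
have BE : ((\int[P]_w (- (U w)%:E)) = \int[P]_w B w)%E.
  apply: ae_eq_integral => //.
    apply: measurable_fun_ifT => //.
    apply: (measurable_fun_bool true); rewrite setTI.
    have := stopping_time_never exit_time_stopping.
    by congr (measurable _); apply/seteqP; split => w /= /eqP.
  exists [set w | T w = +oo%E]; split.
  - exact: stopping_time_never exit_time_stopping.
  - exact: exit_never_null.
  - move=> w /= nE; apply: contrapT => Tw; apply: nE => _.
    by rewrite /B (negbTE (introN eqP Tw)) EFinN.
rewrite BE; apply: le_integral_pointwise => w; rewrite /B.
case: ifPn => [_|Tw]; first exact: leNye.
by apply: payoff_deviation_le; rewrite ltey.
Qed.

End Deviation.

Lemma never_double_equilibrium (c : cube) :
  equilibrium P F W p0 x y tie c standard.
Proof.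
have adm k : admissible F (standard k).
  exact: (never_double_admissible k measurable_accept_if_cheaper).
have gainE n c' h w : gain_upto W p0 x y tie standard n c' h w = outcome W p0 w.
  case: n => [|n] //.
  have [[]//|[k [_ koo _ _]]] := gain_uptoSP W p0 x y tie standard w n c' h.
  by rewrite ltxx in koo.
have payE k w : payoff W p0 x y tie standard c k w =
    (sign_of k * outcome W p0 w)%:E.
  by rewrite (payoff_eventually k (fun n => gainE n.+2 c [::] w)).
split => // [k|k s' adm'].
  rewrite (funext (payE k)).
  have := doubled_outcome_integrable 0 Centered k ler01.
  by rewrite /=; under eq_fun do rewrite mul1r.
rewrite /expected_payoff; under [X in (_ <= X)%E]eq_integral do rewrite payE.
exact: integral_le_deviation.
Qed.

End Position.

(** * The four cases *)

Lemma double_at_optimal (x y : R) (tie : player) (D o : R) (b : bool) :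
  0 < y -> o = 1 \/ o = -1 -> 0 <= D ->
  [/\ o <= D * o, D * o <= x & D * o <= y * o] ->
  (b -> o <= y * o /\ y * o <= D * o) ->
  (~~ b -> [/\ o <= - x, D * o <= - x, - (D * o) <= - x & 0 <= - x]) ->
  optimal_doubling P F W x y tie (double_at W ((1 + o) / 2)).
Proof.
move=> y0 o1 D0 D_own D_acc D_fold; exists (fun=> b) => p0 c p01.
exact: (double_at_equilibrium p01 tie y0 o1 D0 D_own D_acc D_fold).
Qed.

Lemma never_double_optimal (x y : R) (tie : player) :
  x < 0 -> 0 < y -> 1 < - x \/ 1 < y ->
  optimal_doubling P F W x y tie (@never_double _ Omega R).
Proof.
move=> x0 y0 xy; exists (accept_if_cheaper x y) => p0 c p01.
exact: never_double_equilibrium.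
Qed.

End Brownian.

Theorem theorem3p1 (d : measure_display) (Omega : measurableType d)
    (R : realType) (P : probability Omega R) (F : R -> set (set Omega))
    (sigma : R) (W : R -> Omega -> R) (x y : R) (tie : player)
    (HF : filtration F) (Hsigma : 0 < sigma)
    (HW : brownian_motion P F sigma W) (Hy : 0 < y) :
  [/\ y <= x /\ 0 <= y -> 1 < y ->
        optimal_doubling P F W x y tie (double_at W 1),
      0 <= x -> y <= 1 ->
        optimal_doubling P F W x y tie (double_at W 0),
      x < 0 -> 1 < - x \/ 1 < y ->
        optimal_doubling P F W x y tie never_double
    & -1 <= x /\ x <= 0 -> y <= - x ->
        optimal_doubling P F W x y tie (double_at W 0)].
Proof.
have double1 : (1 + 1) / 2 = 1 :> R by field.
have double0 : (1 + -1) / 2 = 0 :> R by rewrite subrr mul0r.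
split => [[yx _] y1|x0 y1|x0 xy|[x1 x0] yx].
- rewrite -double1.
  apply: (@double_at_optimal _ _ _ F HF P sigma W HW x y tie y 1 true) => //.
  + by left.
  + exact: ltW.
  + by split; lra.
  + by move=> _; split; lra.
- rewrite -double0.
  apply: (@double_at_optimal _ _ _ F HF P sigma W HW x y tie y (-1) true) => //.
  + by right.
  + exact: ltW.
  + by split; lra.
  + by move=> _; split; lra.
- exact: (never_double_optimal HF HW).
- rewrite -double0.
  apply: (@double_at_optimal _ _ _ F HF P sigma W HW x y tie (- x) (-1) false) => //.
  + by right.
  + by rewrite oppr_ge0.
  + by split; lra.
  + by move=> _; split; lra.
Qed.
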